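(* For all $n\geq 0$, \[\overline{pl}_5(12n+1)\equiv \overline{p}(12n+1)\pmod 8\quad\text{and}\quad \overline{pl}_5(12n+5)\equiv \overline{p}(12n+5)\pmod 8.\]
   Context: A plane overpartition of $n$ is a plane partition of $n$ (an array $(\pi_{ij})_{i,j\geq1}$ of nonnegative integers, weakly decreasing along rows and down columns, with $\sum\pi_{ij}=n$) in which entries may be overlined subject to: in each row, the last occurrence of an integer may be overlined or not and all other occurrences of that integer in the row are not overlined; in each column, the first occurrence of an integer may be overlined or not and all other occurrences of that integer in the column are overlined. A $k$-rowed plane overpartition is a plane overpartition with at most $k$ (nonzero) rows; $\overline{pl}_k(n)$ is their number ($\overline{pl}_k(0)=1$), with generating function $\sum_{n\geq0}\overline{pl}_k(n)q^n=\prod_{n\geq1}\left(\frac{1+q^n}{1-q^n}\right)^{\min\{k,n\}}$. An overpartition of $n$ is a partition of $n$ in which the first occurrence of each part may be overlined; $\overline{p}(n)$ is the number of overpartitions of $n$ ($\overline{p}(0)=1$), with generating function $\prod_{n\geq1}\frac{1+q^n}{1-q^n}$. *)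

(* Defs.v *)
From mathcomp Require Import all_boot.
Set Implicit Arguments.
Unset Strict Implicit.
Unset Printing Implicit Defensive.

(* In a plane partition of n a positive entry at (zero-based) position (i, j)
   forces (i + 1) * (j + 1) <= n, and every entry is at most n.  So an array
   indexed by all pairs of naturals is determined by its restriction to
   'I_n * 'I_n, with values in 'I_n.+1; outside this range it is 0.
   The boolean component records whether the entry is overlined. *)
Notation marked_array n := {ffun 'I_n * 'I_n -> 'I_n.+1 * bool}.

Definition entry n (a : marked_array n) (i j : 'I_n) : nat := (a (i, j)).1.
Definition overlined n (a : marked_array n) (i j : 'I_n) : bool := (a (i, j)).2.

Definition is_plane_partition n (a : marked_array n) : bool :=
  [&& [forall i : 'I_n, forall j1 : 'I_n, forall j2 : 'I_n,
         (j1 <= j2) ==> (entry a i j2 <= entry a i j1)],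
      [forall j : 'I_n, forall i1 : 'I_n, forall i2 : 'I_n,
         (i1 <= i2) ==> (entry a i2 j <= entry a i1 j)]
    & \sum_(i < n) \sum_(j < n) entry a i j == n].

(* The overlining rules concern the positive entries only; a zero means that
   there is no part at that position, and is never overlined. *)
Definition is_plane_overpartition n (a : marked_array n) : bool :=
  [&& is_plane_partition a,
      [forall i : 'I_n, forall j : 'I_n,
         (entry a i j == 0) ==> ~~ overlined a i j],
      [forall i : 'I_n, forall j : 'I_n,
         [&& 0 < entry a i j
           & [exists j' : 'I_n, (j < j') && (entry a i j' == entry a i j)]]
         ==> ~~ overlined a i j]
    & [forall j : 'I_n, forall i : 'I_n,
         [&& 0 < entry a i j
           & [exists i' : 'I_n, (i' < i) && (entry a i' j == entry a i j)]]
         ==> overlined a i j]].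

Definition num_rows n (a : marked_array n) : nat :=
  #|[set i : 'I_n | [exists j : 'I_n, 0 < entry a i j]]|.

Definition plbar (k n : nat) : nat :=
  #|[set a : marked_array n | is_plane_overpartition a & num_rows a <= k]|.

(* A partition of n is a weakly decreasing sequence of n naturals with sum n,
   padded with zeros; the boolean component records overlining. *)
Notation marked_sequence n := {ffun 'I_n -> 'I_n.+1 * bool}.

Definition part n (s : marked_sequence n) (i : 'I_n) : nat := (s i).1.
Definition part_overlined n (s : marked_sequence n) (i : 'I_n) : bool :=
  (s i).2.

Definition is_partition n (s : marked_sequence n) : bool :=
  [forall i1 : 'I_n, forall i2 : 'I_n,
     (i1 <= i2) ==> (part s i2 <= part s i1)]
  && (\sum_(i < n) part s i == n).

Definition is_overpartition n (s : marked_sequence n) : bool :=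
  [&& is_partition s,
      [forall i : 'I_n, (part s i == 0) ==> ~~ part_overlined s i]
    & [forall i : 'I_n,
         [&& 0 < part s i
           & [exists i' : 'I_n, (i' < i) && (part s i' == part s i)]]
         ==> ~~ part_overlined s i]].

Definition pbar (n : nat) : nat :=
  #|[set s : marked_sequence n | is_overpartition s]|.

(* Main.v *)
(* Forget the overlining: over a fixed plane partition the number of admissible
   overlinings is 0 if some 2 x 2 block is constant, and otherwise 2 to the number
   of free cells (corners), namely the positive cells that differ from both their
   right and their upper neighbour.  Hence only arrays with one or two corners
   matter modulo 8.  One corner means a constant hook; two corners mean a hook of
   size m1 filled with a, surrounded by a connected border strip of size m2 filled
   with b < a.  Likewise, modulo 8 only overpartitions with one or two distinct
   part sizes count.  For N = 1, 5 mod 12 every divisor m of N is 1 or at least 5,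
   so N has, modulo 4, as many hooks min(5, m) with at most five rows as divisors.
   For two values one needs the parity of the number c(m1, m2) of pairs (hook,
   strip) with at most five rows, and that the sum of c(m1, m2) - 1 over the
   solutions of a m1 + b m2 = N with a > b is even.  Up to finitely many (m1, m2),
   c(m1, m2) - 1 is odd according to whether m1 or m2 is 2 or 4, or m1 - m2 is
   +-2 or +-4; the first kind of solution is counted, for 2 as for 4, by the
   squares below N, and the second kind can be enumerated by a + b. *)

Require Import Defs.
From mathcomp Require Import all_boot zify.
Set Implicit Arguments.
Unset Strict Implicit.
Unset Printing Implicit Defensive.

(** * Parity of the number of solutions of a m1 + b m2 = N *)

Notation "\xor_ ( i : T ) F" := (\big[addb/false]_(i : T) F)
  (at level 36, F at level 36, i at level 50, format "\xor_ ( i  :  T )  F").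
Notation "\xor_ ( i < n ) F" := (\big[addb/false]_(i < n) F)
  (at level 36, F at level 36, i, n at level 50, format "\xor_ ( i  <  n )  F").

Lemma xor_unique (T : finType) (P : pred T) :
  (forall x y, P x -> P y -> x = y) -> \xor_(x : T) P x = [exists x, P x].
Proof.
move=> uniqP; case: existsP => [[x Px]|nP]; last first.
  by rewrite big1 // => x _; apply/negbTE/negP => Px; apply: nP; exists x.
rewrite (bigD1 x) //= Px big1 // => y /eqP ne; apply/negbTE/negP => Py.
exact/ne/uniqP.
Qed.

(** The side condition ensures that when [m] is out of range both sides are [false]. *)
Lemma xor_collapse n m (R : pred nat) :
  (R m -> m < n) -> \xor_(i < n) ((nat_of_ord i == m) && R i) = R m.
Proof.
move=> Rm; rewrite xor_unique; last first.
  by move=> i j /andP[/eqP ei _] /andP[/eqP ej _]; apply: val_inj; rewrite /= ei.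
apply/existsP/idP => [[i /andP[/eqP <-]] //|h].
by exists (Ordinal (Rm h)); rewrite /= eqxx.
Qed.

(** Off the diagonal the terms at [(i, j)] and [(j, i)] cancel modulo 2. *)
Lemma xor_sym n (A : 'I_n -> 'I_n -> bool) :
  (forall i j, A i j = A j i) ->
  \xor_(i < n) (\xor_(j < n) A i j) = \xor_(i < n) A i i.
Proof.
move=> Asym.
pose L (i j : 'I_n) := (j < i) && A i j.
have split_row i : \xor_(j < n) A i j =
    (\xor_(j < n) L i j) (+) ((\xor_(j < n) L j i) (+) A i i).
  transitivity (\xor_(j < n) (L i j (+) (L j i (+) ((j == i) && A i j)))).
    apply: eq_bigr => j _; rewrite /L (Asym j i) -val_eqE /=.
    by case: ltngtP => //=; case: (A i j).
  rewrite !big_split /=; congr (_ (+) (_ (+) _)).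
  rewrite xor_unique; last by move=> j k /andP[/eqP -> _] /andP[/eqP -> _].
  by apply/existsP/idP => [[j /andP[/eqP ->]] //|h]; exists i; rewrite eqxx.
rewrite (eq_bigr _ (fun i _ => split_row i)) !big_split /=.
by rewrite exchange_big addbA addbb.
Qed.

(** Substitute [c = x + y]; the bound on [Q] keeps every relevant [c] within the range of
    summation. *)
Lemma xor_shift n y (Q : pred nat) : (forall c, Q c -> c < n) ->
  \xor_(x < n) ((0 < x) && Q (x + y)) = \xor_(c < n) ((y < c) && Q c).
Proof.
move=> Qn.
transitivity (\xor_(x < n) \xor_(c < n)
    ((nat_of_ord c == x + y) && ((y < c) && Q c))).
  apply: eq_bigr => x _; rewrite (@xor_collapse _ _ (fun c => (y < c) && Q c)).
    by congr (_ && _); lia.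
  by case/andP=> _ /Qn.
rewrite exchange_big /=; apply: eq_bigr => c _.
transitivity (\xor_(x < n) ((nat_of_ord x == c - y) && ((y < c) && Q c))).
  by apply: eq_bigr => x _; case: (ltnP y c) => //= h; rewrite ?andbF //; congr (_ && _);
    lia.
rewrite (@xor_collapse _ _ (fun=> (y < c) && Q c)) //.
by move=> _; have := ltn_ord c; lia.
Qed.

Lemma xor_mod4 n k : k <= n ->
  \xor_(c < n) ((k <= c) && (c %% 4 == 3)) = odd (n %/ 4) (+) odd (k %/ 4).
Proof.
elim: n => [|n IHn] kn; first by rewrite big_ord0; have -> : k = 0 by lia.
rewrite big_ord_recr /=; have [->|lt] := eqVneq k n.+1.
  rewrite big1; first by rewrite ltnn addbb.
  by move=> [i /= hi] _; apply/negbTE; lia.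
have kn' : k <= n by rewrite -ltnS ltn_neqAle lt.
have -> : n.+1 %/ 4 = n %/ 4 + (n %% 4 == 3) by lia.
by rewrite IHn // kn' oddD oddb addbAC.
Qed.

Lemma xor_interval n k : k < n -> \xor_(y < n) (0 < y <= k) = odd k.
Proof.
elim: k => [|k IHk] kn; first by rewrite big1 // => i _; lia.
transitivity (\xor_(y < n) ((0 < y <= k) (+) ((nat_of_ord y == k.+1) && true))).
  by apply: eq_bigr => y _; lia.
by rewrite big_split /= IHk ?(@xor_collapse _ _ predT) //=; lia.
Qed.

Section Solutions.
Variable N : nat.
Implicit Types g : nat -> nat -> bool.

(* A pair (a, m) stands for m copies of the part a. *)
Local Notation K := ('I_N.+1 * 'I_N.+1)%type.

Definition two_part_sizes (u v : nat * nat) : bool :=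
  [&& 0 < u.1, 0 < u.2, 0 < v.1, 0 < v.2 & u.1 * u.2 + v.1 * v.2 == N].

Local Notation np u := (nat_of_ord u.1, nat_of_ord u.2).

Definition xor_gt g : bool := \xor_(u : K) \xor_(v : K)
  [&& v.1 < u.1, two_part_sizes (np u) (np v) & g u.2 v.2].

Definition xor_neq g : bool := \xor_(u : K) \xor_(v : K)
  [&& u.1 != v.1, two_part_sizes (np u) (np v) & g u.2 v.2].

Lemma two_part_sizesC u v : two_part_sizes u v = two_part_sizes v u.
Proof. by rewrite /two_part_sizes; lia. Qed.

Lemma eq_xor_gt g g' :
  (forall u v, two_part_sizes u v -> g u.2 v.2 = g' u.2 v.2) ->
  xor_gt g = xor_gt g'.
Proof.
move=> e; apply: eq_bigr => u _; apply: eq_bigr => v _; congr (_ && _).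
by case: (boolP (two_part_sizes _ _)) => //= /e.
Qed.

Lemma xor_gtD g g' :
  xor_gt (fun m1 m2 => g m1 m2 (+) g' m1 m2) = xor_gt g (+) xor_gt g'.
Proof.
rewrite -big_split; apply: eq_bigr => u _; rewrite -big_split.
by apply: eq_bigr => v _; case: (_ < _); case: two_part_sizes.
Qed.

Lemma xor_neqD g g' :
  xor_neq (fun m1 m2 => g m1 m2 (+) g' m1 m2) = xor_neq g (+) xor_neq g'.
Proof.
rewrite -big_split; apply: eq_bigr => u _; rewrite -big_split.
by apply: eq_bigr => v _; case: (_ != _); case: two_part_sizes.
Qed.

(** Exchanging the two summands maps solutions with [a > b] to those with [a < b]. The condition
    [a != b] is easier to handle, as its complement [a = b] can be counted. *)
Lemma xor_gt_symmetrize g :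
  xor_gt (fun m1 m2 => g m1 m2 (+) g m2 m1) = xor_neq g.
Proof.
rewrite (xor_gtD g (fun m1 m2 => g m2 m1)) [X in _ (+) X]exchange_big -big_split.
apply: eq_bigr => u _; rewrite -big_split; apply: eq_bigr => v _ /=.
rewrite (two_part_sizesC (np v)) -val_eqE /=.
by case: ltngtP => //=; rewrite ?addbF.
Qed.

Lemma xor_neqE g : xor_neq g =
  \xor_(x < N.+1) \xor_(y < N.+1) \xor_(m1 < N.+1) \xor_(m2 < N.+1)
  [&& x != y, two_part_sizes (nat_of_ord x, nat_of_ord m1) (nat_of_ord y, nat_of_ord m2)
    & g m1 m2].
Proof.
transitivity (\xor_(x < N.+1) \xor_(m1 < N.+1) \xor_(y < N.+1) \xor_(m2 < N.+1)
  [&& x != y, two_part_sizes (nat_of_ord x, nat_of_ord m1) (nat_of_ord y, nat_of_ord m2)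
    & g m1 m2]).
  rewrite pair_bigA; apply: eq_bigr => u _.
  by rewrite pair_bigA; apply: eq_bigr => v _.
by apply: eq_bigr => x _; rewrite exchange_big.
Qed.


Hypothesis N_mod12 : (N %% 12 == 1) || (N %% 12 == 5).

(** With [m1 = m] the equation is [m * x + y * z = N] with [x != y]. Modulo 2 this is the number of
    all triples, where the swap of [y] and [z] leaves only [y = z], plus the number of triples with
    [x = y]. *)
Lemma xor_neq_fst m : m < 5 -> 0 < m ->
  xor_neq (fun m1 _ => m1 == m) =
  (\xor_(y < N.+1) \xor_(x < N.+1) [&& 0 < x, 0 < y & m * x + y * y == N])
  (+) (\xor_(x < N.+1) \xor_(z < N.+1) [&& 0 < x, 0 < z & (m + z) * x == N]).
Proof.
move=> m5 m0; rewrite xor_neqE [in RHS]exchange_big -big_split /=.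
apply: eq_bigr => x _.
transitivity (\xor_(y < N.+1) \xor_(z < N.+1)
  ([&& 0 < x, 0 < y, 0 < z & m * x + y * z == N] (+)
   ((y == x) && [&& 0 < x, 0 < y, 0 < z & m * x + y * z == N]))).
  apply: eq_bigr => y _; rewrite exchange_big; apply: eq_bigr => z _ /=.
  transitivity (\xor_(m1 < N.+1) ((nat_of_ord m1 == m) &&
      [&& x != y, 0 < x, 0 < m1, 0 < y, 0 < z & x * m1 + y * z == N])).
    by apply: eq_bigr => m1 _; rewrite /two_part_sizes /=; lia.
  rewrite (@xor_collapse _ _ (fun m1 =>
      [&& x != y, 0 < x, 0 < m1, 0 < y, 0 < z & x * m1 + y * z == N])).
    rewrite m0 (mulnC x m) (eq_sym y x).
    by case: (x == y); case: (0 < x); case: (0 < y); case: (0 < z);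
      rewrite /= ?addbb ?addbF.
  by nia.
transitivity ((\xor_(y < N.+1) \xor_(z < N.+1)
    [&& 0 < x, 0 < y, 0 < z & m * x + y * z == N]) (+)
  (\xor_(y < N.+1) \xor_(z < N.+1)
    ((y == x) && [&& 0 < x, 0 < y, 0 < z & m * x + y * z == N]))).
  by rewrite -big_split; apply: eq_bigr => y _; rewrite -big_split.
congr (_ (+) _).
  by rewrite xor_sym => [|y z]; [apply: eq_bigr => y _|]; lia.
rewrite exchange_big; apply: eq_bigr => z _ /=.
rewrite (eq_bigr (fun y : 'I_N.+1 => (nat_of_ord y == x) && [&& 0 < x, 0 < y, 0 < z & m *
  x + y * z == N])) //.
rewrite (@xor_collapse _ _ (fun y => [&& 0 < x, 0 < y, 0 < z & m * x + y * z == N])).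
  by lia.
by move=> _.
Qed.

(** In the first term of [xor_neq_fst], [y] is odd, so [N - y * y] is divisible by 4. In the second,
    the divisors of [N] above 2 are those above 4, because 3 and 4 do not divide [N]. *)
Lemma xor_neq_fst24 :
  xor_neq (fun m1 _ => m1 == 2) = xor_neq (fun m1 _ => m1 == 4).
Proof.
rewrite !xor_neq_fst //; congr (_ (+) _); apply: eq_bigr => y _.
  (* For fixed [y] there is at most one solution, so parity becomes existence. *)
  rewrite !xor_unique; last first.
  - by move=> i j /and3P[_ _ /eqP ei] /and3P[_ _ /eqP ej]; apply/val_inj => /=; lia.
  - by move=> i j /and3P[_ _ /eqP ei] /and3P[_ _ /eqP ej]; apply/val_inj => /=; lia.
  apply/existsP/existsP => -[x /and3P[x0 y0 /eqP e]]; last first.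
    have hx : 2 * x < N.+1 by nia.
    by exists (Ordinal hx) => /=; lia.
  have hx : x %/ 2 < N.+1 by have := ltn_ord x; lia.
  exists (Ordinal hx) => /=;
    move: (nat_of_ord x) (nat_of_ord y) x0 y0 e {hx} => {}x {}y x0 y0 e.
  have oddy : y = (y %/ 2) * 2 + 1.
    suff : odd y by lia.
    by have : odd (y * y); [lia | rewrite oddM andbb].
  have yy : y * y = 4 * ((y %/ 2) * (y %/ 2) + y %/ 2) + 1.
    by rewrite {1 2}oddy; move: (y %/ 2) => k; nia.
  by move: (y * y) ((y %/ 2) * (y %/ 2)) yy e; lia.
rewrite !xor_unique; last first.
- by move=> i j /and3P[? _ /eqP ei] /and3P[_ _ /eqP ej]; apply/val_inj => /=; nia.
- by move=> i j /and3P[? _ /eqP ei] /and3P[_ _ /eqP ej]; apply/val_inj => /=; nia.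
apply/existsP/existsP => -[z /and3P[y0 z0 /eqP e]]; last first.
  have hz : z.+2 < N.+1 by nia.
  by exists (Ordinal hz) => /=; nia.
have hz : z - 2 < N.+1 by have := ltn_ord z; lia.
have z3 : 2 < z.
  case: (ltnP 2 z) => // z2; suff : z = 1 :> nat \/ z = 2 :> nat by case=> ez;
    rewrite ez in e; lia.
  by lia.
exists (Ordinal hz) => /=; rewrite y0 /=; apply/andP; split; first by lia.
by apply/eqP; apply: etrans e; congr (_ * _); lia.
Qed.

(** With [m2 = m1 + 2 * t] the equation reads [(a + b) * m1 + 2 * t * b = N]. Here [c] stands for
    [a + b] and [p] for [(m1, b)], so [p.2 < c] expresses that [a] is positive. *)
Definition xor_diff t c : bool := [exists p : 'I_N.+1 * 'I_N.+1,
  [&& 0 < p.1, 0 < p.2, p.2 < c & p.1 * c + t.*2 * p.2 == N]].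

(** For fixed [c = a + b] the solution is unique: two values of [m1] at distance [d] make [d * c] a
    multiple of [2 * t] with [d < 2 * t], and [c] is odd while [2 * t] is 2 or 4, so [d = 0]. *)
Lemma xor_neq_diff (t : nat) : (t == 1) || (t == 2) ->
  xor_neq (fun m1 m2 => m2 == m1 + t.*2) = \xor_(c < N.+1) xor_diff t c.
Proof.
move=> t12; rewrite xor_neqE exchange_big.
pose Q y m c := [&& 0 < y, 0 < m & m * c + t.*2 * y == N].
transitivity (\xor_(y < N.+1) \xor_(m < N.+1) \xor_(x < N.+1) ((0 < x) && Q y m (x + y))).
  apply: eq_bigr => y _; rewrite exchange_big; apply: eq_bigr => m _.
  apply: eq_bigr => x _.
  transitivity (\xor_(z < N.+1) ((nat_of_ord z == m + t.*2) &&
     ([&& x != y, 0 < x, 0 < m, 0 < y, 0 < z & x * m + y * z == N]))).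
    by apply: eq_bigr => z _; rewrite /two_part_sizes /= [RHS]andbC -!andbA.
  rewrite (@xor_collapse _ _ (fun z => [&& x != y, 0 < x, 0 < m, 0 < y, 0 < z & x * m + y
    * z == N])).
    rewrite /Q -val_eqE /=.
    have -> : m * (x + y) + t.*2 * y = x * m + y * (m + t.*2) by lia.
    (* Equal parts [x = y] would give [N = y * (2 * m + 2 * t)], which is even. *)
    case: (eqVneq (nat_of_ord x) y) => [->|_] /=.
      symmetry; apply/negbTE/negP => /and4P[_ _ _ /eqP e].
      by have : odd N; [lia | rewrite -e -mulnDr oddM oddD oddD odd_double addbF addbb
        andbF].
    by lia.
  by case/and5P=> _ _ _ y0 /andP[_ /eqP e]; nia.
rewrite (eq_bigr (fun y : 'I_N.+1 => \xor_(c < N.+1) \xor_(m < N.+1) ((y < c) && Q y m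
  c))); last first.
  move=> y _; rewrite [RHS]exchange_big; apply: eq_bigr => m _.
  by rewrite (@xor_shift _ y (Q y m)) // => c /and3P[_ m0 /eqP <-]; nia.
rewrite exchange_big; apply: eq_bigr => c _; rewrite exchange_big pair_bigA.
rewrite /xor_diff -xor_unique.
  apply: eq_bigr => p _; rewrite /Q /=.
  by case: (0 < p.1); case: (0 < p.2); case: (p.2 < c).
move=> [m y] [m' y'] /= /and4P[_ _ yc /eqP e] /and4P[_ _ yc' /eqP e'].
have oddc : odd c.
  have : odd N by lia.
  move/(congr1 odd): e; rewrite oddD oddM [odd (_ * y)]oddM odd_double /= addbF.
  by move=> <- /andP[].
have em : m = m' :> nat.
  move: (nat_of_ord c) (nat_of_ord m) (nat_of_ord m') (nat_of_ord y) (nat_of_ord y') oddc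
    yc yc' e e'.
  move=> {}c {}m {}m' {}y {}y' oddc yc yc' e e'; clear - t12 oddc yc yc' e e'.
  wlog le : m m' y y' yc yc' e e' / m <= m'.
    move=> H; case: (leqP m m') => [|/ltnW] le; first exact: (H m m' y y').
    by symmetry; exact: (H m' m y' y).
  have [d em'] : exists d, m' = m + d by exists (m' - m); lia.
  have {e'}ed : d * c + t.*2 * y' = t.*2 * y by rewrite em' in e'; lia.
  suff : d = 0 by lia.
  have d4 : d < t.*2.
    have lt : d * c < t.*2 * c.
      by apply: leq_ltn_trans (leq_addr (t.*2 * y') _) _; rewrite ed ltn_mul2l yc; lia.
    by move: lt; rewrite ltn_mul2r => /andP[].
  by case/orP: t12 => /eqP tt; subst t; case: d em' ed d4 => [|[|[|[|]]]] //; lia.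
congr (_, _); apply/val_inj => //=; rewrite em in e.
by case/orP: t12 => /eqP tt; rewrite tt in e e'; lia.
Qed.

(** Write [N = q * c + r]. If [r] is even, take [m1 = q] and [b = r / 2]; if [r] is odd, then [q] is
    even, and [m1 = q - 1], [b = (c + r) / 2] works. Conversely, [c %| N] would force
    [c = 2 * b]. *)
Lemma xor_diff1E c : xor_diff 1 c = [&& odd c, c < N & ~~ (c %| N)].
Proof.
apply/existsP/and3P => [[[m y] /= /and4P[m0 y0 yc /eqP e]]|[oddc cN ndvd]].
  split.
  - by have : odd N; [lia | rewrite -e oddD oddM [in odd (_ * y)]oddM /= addbF;
    case/andP].
  - by nia.
  - apply/negP => /dvdnP[q eq];
    move: (nat_of_ord m) (nat_of_ord y) m0 y0 yc e => {}m {}y m0 y0 yc e.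
    have : q = m.+1 by nia.
    move=> qm; have c2 : c = y.*2 by nia.
    have : odd N by lia.
    by rewrite eq c2 oddM odd_double andbF.
have [q [r [eN rc]]] : exists q, exists r, N = q * c + r /\ r < c.
  by exists (N %/ c), (N %% c); rewrite -divn_eq ltn_mod; split => //; lia.
have r0 : 0 < r.
  by rewrite lt0n; apply/eqP => r0; case/negP: ndvd; rewrite eN r0 addn0 dvdn_mull.
have oN : odd N by lia.
have q0 : 0 < q by nia.
case: (boolP (odd q)) => oq.
  have or : ~~ odd r by move: oN; rewrite eN oddD oddM oq oddc.
  have hq : q < N.+1 by nia.
  have hr : r./2 < N.+1 by lia.
  by exists (Ordinal hq, Ordinal hr) => /=; lia.
have q1 : 1 < q by lia.
have or : odd r by move: oN; rewrite eN oddD oddM (negbTE oq).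
have hq : q.-1 < N.+1 by nia.
have hr : (c + r)./2 < N.+1 by nia.
exists (Ordinal hq, Ordinal hr) => /=.
have -> : q.-1 * c + 2 * (c + r)./2 == N.
  apply/eqP; rewrite eN; have -> : 2 * (c + r)./2 = c + r by lia.
  by case: (q) q0 => //= k _; lia.
by lia.
Qed.

(** Modulo 4, [m1 * c + 4 * b = N] says that [m1] and [c] are congruent; so if [c] is 3 modulo 4,
    then [m1 >= 3] and [3 * c < N]. Conversely, the quotient of [N] by [c] is lowered by the [d < 4]
    that makes [d * c + r] divisible by 4. *)
Lemma xor_diff2E c :
  xor_diff 2 c = [&& odd c, c < N, ~~ (c %| N) & (c %% 4 == 1) || (3 * c < N)].
Proof.
apply/existsP/and4P => [[[m y] /= /and4P[m0 y0 yc /eqP e]]|[oddc cN ndvd c1]].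
  have oddc : odd c.
    by have : odd N; [lia | rewrite -e oddD oddM [in odd (_ * y)]oddM /= addbF;
      case/andP].
  split => //.
  - by nia.
  - apply/negP => /dvdnP[q eq];
    move: (nat_of_ord m) (nat_of_ord y) m0 y0 yc e => {}m {}y m0 y0 yc e.
    have [d [qm d0 d4]] : exists d, [/\ q = m + d, 0 < d & d < 4].
      by exists (q - m); split; nia.
    have {}e : d * c = 4 * y by nia.
    by case: d qm d0 d4 e => [|[|[|[|]]]] // _ _ _; lia.
  - case: (eqVneq (c %% 4) 1) => //= c3; case: (ltnP 2 m) => m3; first by nia.
    have [] : m = 1 :> nat \/ m = 2 :> nat by lia.
      by move=> em; rewrite em in e; lia.
    by move=> em; rewrite em in e; lia.
have [q [r [eN rc]]] : exists q, exists r, N = q * c + r /\ r < c.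
  by exists (N %/ c), (N %% c); rewrite -divn_eq ltn_mod; split => //; lia.
have r0 : 0 < r.
  by rewrite lt0n; apply/eqP => r0; case/negP: ndvd; rewrite eN r0 addn0 dvdn_mull.
have [d [d4 hd]] : exists d, d < 4 /\ (d * c + r) %% 4 = 0.
  have : c %% 4 = 1 \/ c %% 4 = 3 by lia.
  move=> h; have : r %% 4 < 4 by rewrite ltn_mod.
  have ec := divn_eq c 4; move: (c %/ 4) ec => k ec r4.
  (* As [c] is 1 or -1 modulo 4, [d] is the residue of [-r] or of [r]. *)
  pose d := if c %% 4 == 1 then (4 - r %% 4) %% 4 else r %% 4.
  exists d; split; first by rewrite /d; case: ifP; lia.
  by rewrite ec mulnDr mulnA; move: (d * k) => dk; case: h => h; rewrite /d h /=; lia.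
(* Otherwise [d = q + f] with [f * c + N] divisible by 4, so [f] is 3 or 1 as [c] is 1 or 3 modulo
   4. The first contradicts [d < 4]; the second gives [q <= 2], against [3 * c < N]. *)
have dq : d < q.
  rewrite ltnNge; apply/negP => qd.
  have c13 : c %% 4 = 1 \/ c %% 4 = 3 by lia.
  have [f ef] : exists f, d = q + f by exists (d - q); lia.
  have {}hd : (f * c + N) %% 4 = 0.
    by rewrite eN addnA -mulnDl (addnC f) -ef.
  have f4 : f < 4 by lia.
  have q0 : 0 < q by rewrite lt0n; apply/eqP => q0; rewrite q0 in eN; lia.
  have N4 : N %% 4 = 1 by lia.
  have f13 : f = if c %% 4 == 1 then 3 else 1.
    by clear - N4 c13 hd f4; case: f f4 hd => [|[|[|[|]]]] // _ hd; case: c13 => h;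
      rewrite h /=; lia.
  case: c13 => h; rewrite h /= in f13 c1; first by lia.
  have : 2 < q by rewrite ltnNge; apply/negP => q2; have : q * c <= 2 * c;
    [rewrite leq_mul2r q2 orbT|lia].
  lia.
have hq : q - d < N.+1 by nia.
have dc : d * c <= q * c by rewrite leq_mul2r ltnW ?orbT.
have hr : (d * c + r) %/ 4 < N.+1 by lia.
exists (Ordinal hq, Ordinal hr) => /=.
have -> : (q - d) * c + 4 * ((d * c + r) %/ 4) == N.
  have -> : 4 * ((d * c + r) %/ 4) = d * c + r by lia.
  by rewrite addnA -mulnDl subnK ?eN // ltnW.
by have : d * c <= 3 * c; [rewrite leq_mul2r; lia|lia].
Qed.

(** The two criteria differ exactly at those non-divisors [c < N] that are 3 modulo 4 and satisfy
    [3 * c > N]. A divisor in this range would have cofactor 1 or 2, but [N] is odd and is not 3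
    modulo 4. *)
Lemma xor_neq_diff12 :
  xor_neq (fun m1 m2 => m2 == m1 + 2) (+) xor_neq (fun m1 m2 => m2 == m1 + 4) =
  odd (N.+1 %/ 4) (+) odd ((N %/ 3).+1 %/ 4).
Proof.
rewrite (@xor_neq_diff 1) // (@xor_neq_diff 2) // -big_split -xor_mod4; last by lia.
apply: eq_bigr => c _; rewrite /= xor_diff1E xor_diff2E.
case: (boolP (c %| N)) => [/dvdnP[q e]|_]; last by have := ltn_ord c; lia.
rewrite /= !andbF /=; symmetry; apply/negbTE/negP => /andP[lt c3].
have q3 : q < 3.
  by rewrite ltnNge; apply/negP => q3; have : 3 * c <= q * c;
    [rewrite leq_mul2r q3 orbT|lia].
by case: q e q3 => [|[|[|]]] //; lia.
Qed.

(** In [x + 3 * y = N] the case [x = y] would make 4 divide [N], so [y] runs through all of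
    [1, ..., N.-1 %/ 3]. *)
Lemma xor_neq_13 :
  xor_neq (fun m1 m2 => (m1 == 1) && (m2 == 3)) = odd (N.-1 %/ 3).
Proof.
rewrite xor_neqE exchange_big -(@xor_interval N.+1); last by lia.
apply: eq_bigr => y _;
  transitivity (\xor_(x < N.+1) ((nat_of_ord x == N - 3 * y) && (0 < y <= N.-1 %/ 3))).
  apply: eq_bigr => x _.
  transitivity (\xor_(m1 < N.+1) ((nat_of_ord m1 == 1) &&
     [&& 0 < y, 0 < x & x + 3 * y == N])).
    apply: eq_bigr => m1 _.
    transitivity (\xor_(m2 < N.+1) ((nat_of_ord m2 == 3) && [&& m1 == 1 :> nat, 0 < y, 0
      < x & x + 3 * y == N])).
      apply: eq_bigr => m2 _; rewrite /two_part_sizes /= -val_eqE /=.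
      case: (eqVneq (nat_of_ord m1) 1) => [->|_]; rewrite ?andbF //=.
      by case: (eqVneq (nat_of_ord m2) 3) => [->|_]; rewrite ?andbF //=; lia.
    rewrite (@xor_collapse _ _ (fun=> [&& m1 == 1 :> nat, 0 < y, 0 < x & x + 3 * y ==
      N])) //.
    by lia.
  by rewrite (@xor_collapse _ _ (fun=> [&& 0 < y, 0 < x & x + 3 * y == N])) //; lia.
by rewrite (@xor_collapse _ _ (fun=> 0 < y <= N.-1 %/ 3)) //; lia.
Qed.

Lemma xor_gt_11 :
  xor_gt (fun m1 m2 => (m1 == 1) && (m2 == 1)) = odd (N.-1 %/ 2).
Proof.
transitivity (\xor_(b < N.+1) \xor_(m2 < N.+1) \xor_(a < N.+1) \xor_(m1 < N.+1)
  [&& b < a, two_part_sizes (nat_of_ord a, nat_of_ord m1) (nat_of_ord b, nat_of_ord m2)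
   & (nat_of_ord m1 == 1) && (nat_of_ord m2 == 1)]).
  rewrite pair_bigA /xor_gt exchange_big; apply: eq_bigr => v _.
  by rewrite pair_bigA; apply: eq_bigr => u _.
rewrite -(@xor_interval N.+1); last by lia.
apply: eq_bigr => b _.
transitivity (\xor_(m2 < N.+1) ((nat_of_ord m2 == 1) && (0 < b <= N.-1 %/ 2)));
  last first.
  by rewrite (@xor_collapse _ _ (fun=> 0 < b <= N.-1 %/ 2)) //; lia.
apply: eq_bigr => m2 _.
transitivity (\xor_(a < N.+1) ((nat_of_ord a == N - b) && ((nat_of_ord m2 == 1) && (0 < b
  <= N.-1 %/ 2)))); last first.
  by rewrite (@xor_collapse _ _ (fun=> (nat_of_ord m2 == 1) && (0 < b <= N.-1 %/ 2))) //;
    lia.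
apply: eq_bigr => a _.
transitivity (\xor_(m1 < N.+1) ((nat_of_ord m1 == 1) &&
     [&& nat_of_ord m2 == 1, b < a, 0 < b & a + b == N])).
  apply: eq_bigr => m1 _; rewrite /two_part_sizes /=.
  case: (eqVneq (nat_of_ord m1) 1) => [->|_]; rewrite ?andbF //=.
  by case: (eqVneq (nat_of_ord m2) 1) => [->|_]; rewrite ?andbF //=; lia.
by rewrite (@xor_collapse _ _ (fun=> [&& nat_of_ord m2 == 1, b < a, 0 < b & a + b == N]))
  //; lia.
Qed.

(* The parity of c - 1, for c the number of pairs of a hook of size m1 and a
   connected border strip of size m2 around it, within five rows. *)
Definition strip_parity (m1 m2 : nat) : bool :=
  ((m1 == 2) || (m1 == 4)) (+) ((m2 == 2) || (m2 == 4)) (+)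
  [|| m2 == m1 + 2, m2 == m1 + 4, m1 == m2 + 2 | m1 == m2 + 4] (+)
  ((m1, m2) \in [:: (1, 1); (2, 2); (1, 3); (3, 1); (2, 4); (4, 2)]).

End Solutions.

(** Adding its transpose gives [strip_parity] up to the self-transposed pair [(1, 1)], so that
    [xor_gt_symmetrize] applies. *)
Definition half_strip_parity (m1 m2 : nat) : bool :=
  (m1 == 2) (+) (m1 == 4) (+) ((m2 == m1 + 2) (+) (m2 == m1 + 4))
  (+) ((m1 == 1) && (m2 == 3)).

(** As [N] is odd, the sizes in a solution are not both even; this discards the exceptional pairs
    [(2, 2)], [(2, 4)] and [(4, 2)]. *)
Lemma strip_parity_symmetrized m1 m2 : odd m1 || odd m2 ->
  strip_parity m1 m2 = half_strip_parity m1 m2 (+) half_strip_parity m2 m1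
    (+) ((m1 == 1) && (m2 == 1)).
Proof.
rewrite /strip_parity /half_strip_parity !inE !xpair_eqE.
case: (ltnP 4 m1) => h1; last first.
  (* The other size is split up to 8, the largest possible value of [m1 + 4]. *)
  by move: m1 h1 => [|[|[|[|[|//]]]]] _;
     move: m2 => [|[|[|[|[|[|[|[|[|m2]]]]]]]]].
case: (ltnP 4 m2) => h2; last first.
  by move: m2 h2 => [|[|[|[|[|//]]]]] _;
     move: m1 h1 => [|[|[|[|[|[|[|[|[|m1]]]]]]]]].
move=> _; have small m : 4 < m ->
  ((m == 1) = false) * ((m == 2) = false) * ((m == 3) = false) * ((m == 4) = false).
  by case: m => [|[|[|[|[|m]]]]].
rewrite !(small m1 h1) !(small m2 h2) /=.
have -> : [|| m2 == m1 + 2, m2 == m1 + 4, m1 == m2 + 2 | m1 == m2 + 4] =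
      ((m2 == m1 + 2) (+) (m2 == m1 + 4)) (+) ((m1 == m2 + 2) (+) (m1 == m2 + 4)).
  by clear; lia.
by rewrite !addbF.
Qed.

(** The terms for 2 and 4 cancel. What remains is the parity of [3q + q + 4q + 6q] for
    [N = 12q + 1], and of [(3q + 1) + q + (4q + 1) + (6q + 2)] for [N = 12q + 5]. *)
Lemma xor_gt_strip_parity N : (N %% 12 == 1) || (N %% 12 == 5) ->
  xor_gt N strip_parity = false.
Proof.
move=> N_mod12.
rewrite (@eq_xor_gt _ _ (fun m1 m2 => (half_strip_parity m1 m2 (+) half_strip_parity m2
  m1)
    (+) ((m1 == 1) && (m2 == 1)))); last first.
  move=> [a m1] [b m2] /= /and5P[_ _ _ _ /eqP e]; apply: strip_parity_symmetrized.
  have : odd N by lia.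
  by rewrite -e oddD !oddM /=; do 4!case: (odd _).
rewrite xor_gtD xor_gt_symmetrize.
rewrite !xor_neqD xor_neq_fst24 // addbb xor_neq_diff12 // xor_neq_13 // xor_gt_11 //.
have [q [] eN] : exists q, N = 12 * q + 1 \/ N = 12 * q + 5 by exists (N %/ 12); lia.
  have -> : N.+1 %/ 4 = 3 * q by lia.
  have -> : (N %/ 3).+1 %/ 4 = q by lia.
  have -> : N.-1 %/ 3 = 4 * q by lia.
  have -> : N.-1 %/ 2 = 6 * q by lia.
  by rewrite !oddM /=; case: (odd q).
have -> : N.+1 %/ 4 = (3 * q).+1 by lia.
have -> : (N %/ 3).+1 %/ 4 = q by lia.
have -> : N.-1 %/ 3 = (4 * q).+1 by lia.
have -> : N.-1 %/ 2 = (6 * q).+2 by lia.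
by rewrite !oddS !oddM /=; case: (odd q).
Qed.

(** * Hooks and border strips within five rows *)

(** Row lengths of the hook with [m] cells and [h] rows; below the first row the Boolean [i < h] is
    read as the length 1 or 0. *)
Definition hook (m h i : nat) : nat := if i == 0 then m.+1 - h else i < h.

Lemma hook_anti m h i j : h <= m -> i <= j -> hook m h j <= hook m h i.
Proof. by rewrite /hook; do 2!case: eqP; lia. Qed.

Section Strip.
Variables m1 m2 h i0 i1 : nat.

(* Adding a connected border strip in the rows i0, ..., i1 makes row i.+1, for
   i0 <= i < i1, one cell longer than the old row i; so the total m2 of added
   cells determines the new length of row i0. *)
Definition strip_top : nat := m2 + hook m1 h i1 - (i1 - i0).

Definition hook_strip (i : nat) : nat :=
  if (i < i0) || (i1 < i) then hook m1 h i
  else if i == i0 then strip_top else (hook m1 h i.-1).+1.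

(** The top row of the strip gains a cell and does not pass the unchanged row above it; the lower
    rows fit by construction. If the subtraction in [strip_top] truncates, then [strip_top] is 0 and
    the strict inequality fails. *)
Definition strip_fits : bool :=
  [&& 0 < h, h <= m1, i0 <= i1, hook m1 h i0 < strip_top
    & (i0 == 0) || (strip_top <= hook m1 h i0.-1)].

End Strip.

Definition strip_count (m1 m2 : nat) : nat :=
  \sum_(h < 5) \sum_(i0 < 5) \sum_(i1 < 5) strip_fits m1 m2 h.+1 i0 i1.

Lemma sum_ordE n (F : nat -> nat) : \sum_(i < n) F i = sumn (map F (iota 0 n)).
Proof. by rewrite sumnE big_map -(big_mkord xpredT) /index_iota subn0. Qed.

(** The form on lists is the one evaluated by [vm_compute] in [odd_strip_count]. *)
Lemma strip_countE m1 m2 : strip_count m1 m2 =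
  sumn [seq sumn [seq sumn [seq nat_of_bool (strip_fits m1 m2 h.+1 i0 i1)
    | i1 <- iota 0 5] | i0 <- iota 0 5] | h <- iota 0 5].
Proof.
rewrite /strip_count -sum_ordE; apply: eq_bigr => h _.
rewrite -sum_ordE; apply: eq_bigr => i0 _.
by rewrite -(sum_ordE 5 (fun i1 => strip_fits m1 m2 h.+1 i0 i1)).
Qed.

Ltac case_ord i := case: i => [[|[|[|[|[|//]]]]] ?].

(** For sizes above 4, each of the 125 instances of [strip_fits] depends only on the difference of
    the sizes. *)
Lemma strip_count_shift m1 m2 : 4 < m1 -> 4 < m2 ->
  strip_count m1.+1 m2.+1 = strip_count m1 m2.
Proof.
move=> h1 h2; apply: eq_bigr => h _; apply: eq_bigr => i0 _.
apply: eq_bigr => i1 _; congr nat_of_bool; rewrite /strip_fits /strip_top /hook.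
by case_ord h; case_ord i0; case_ord i1; rewrite /=; lia.
Qed.

(** So long a strip can only start in row 0: started lower, it would pass the first row of the
    hook. *)
Lemma strip_count_shiftr m1 m2 : 0 < m1 -> m1 + 5 < m2 ->
  strip_count m1 m2.+1 = strip_count m1 m2.
Proof.
move=> h1 h2; apply: eq_bigr => h _; apply: eq_bigr => i0 _.
apply: eq_bigr => i1 _; congr nat_of_bool; rewrite /strip_fits /strip_top /hook.
by case_ord h; case_ord i0; case_ord i1; rewrite /=; lia.
Qed.

(** The first row of the hook is too long to be passed by a strip that reaches a lower row, and it
    leaves room for any strip starting in row 1. *)
Lemma strip_count_shiftl m1 m2 : 0 < m2 -> m2 + 5 < m1 ->
  strip_count m1.+1 m2 = strip_count m1 m2.
Proof.
move=> h1 h2; apply: eq_bigr => h _; apply: eq_bigr => i0 _.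
apply: eq_bigr => i1 _; congr nat_of_bool; rewrite /strip_fits /strip_top /hook.
by case_ord h; case_ord i0; case_ord i1; rewrite /=; lia.
Qed.

Lemma strip_parity_shift m1 m2 : 4 < m1 -> 4 < m2 ->
  strip_parity m1.+1 m2.+1 = strip_parity m1 m2.
Proof.
by rewrite /strip_parity !inE !xpair_eqE => h1 h2;
  case: m1 h1 => [|[|[|[|[|k]]]]] //; case: m2 h2 => [|[|[|[|[|l]]]]].
Qed.

Lemma strip_parity_shiftr m1 m2 : 0 < m1 -> m1 + 5 < m2 ->
  strip_parity m1 m2.+1 = strip_parity m1 m2.
Proof.
rewrite /strip_parity !inE !xpair_eqE => h1 h2.
have -> : [|| m2 == m1 + 2, m2 == m1 + 4, m1 == m2 + 2 | m1 == m2 + 4] = false by lia.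
have -> : [|| m2.+1 == m1 + 2, m2.+1 == m1 + 4, m1 == m2.+1 + 2 | m1 == m2.+1 + 4] =
  false by lia.
by case: m2 h2 => [|[|[|[|[|k]]]]] h2; rewrite ?andbF //=; lia.
Qed.

Lemma strip_parityC m1 m2 : strip_parity m1 m2 = strip_parity m2 m1.
Proof.
rewrite /strip_parity !inE !xpair_eqE; congr (_ (+) _ (+) _); first exact: addbC.
  by lia.
by clear; do !case: (_ == _).
Qed.

(** The shift lemmas reduce to sizes at most 11, where a table is evaluated. The bound 11 arises
    because, once one size is at most 5, the other can be lowered as long as its predecessor is
    above 10. *)
Lemma odd_strip_count m1 m2 : 0 < m1 -> 0 < m2 ->
  odd (strip_count m1 m2) = ~~ strip_parity m1 m2.
Proof.
move: {2}(m1 + m2) (leqnn (m1 + m2)) => n; elim: n m1 m2 => [|n IHn] m1 m2 le h1 h2.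
  by lia.
case: (boolP ((5 < m1) && (5 < m2))) => [/andP[m1_5 m2_5]|small].
  case: m1 m1_5 le h1 => // m1 m1_5 le h1; case: m2 m2_5 le h2 => // m2 m2_5 le h2.
  by rewrite strip_count_shift // strip_parity_shift // IHn; lia.
case: (leqP m1 11) => b1; last first.
  case: m1 b1 le h1 small => // m1 b1 le h1 small.
  (* By symmetry [strip_parity_shiftr] also serves for the first argument. *)
  rewrite strip_count_shiftl // 1?strip_parityC ?strip_parity_shiftr -1?strip_parityC
    ?IHn //; lia.
case: (leqP m2 11) => b2; last first.
  case: m2 b2 le h2 small => // m2 b2 le h2 small.
  by rewrite strip_count_shiftr // ?strip_parity_shiftr ?IHn //; lia.
have base : all (fun i => all (fun j =>
   odd (sumn [seq sumn [seq sumn [seq nat_of_bool (strip_fits i j h.+1 i0 i1)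
    | i1 <- iota 0 5] | i0 <- iota 0 5] | h <- iota 0 5]) == ~~ strip_parity i j)
   (iota 1 11)) (iota 1 11).
  by vm_compute.
rewrite strip_countE; apply/eqP.
by apply: (allP (allP base m1 _)); rewrite mem_iota; lia.
Qed.

Lemma sum_ltn n w : \sum_(j < n) (j < w) = minn n w.
Proof. by elim: n => [|n IHn]; rewrite ?big_ord0 ?big_ord_recr /= ?IHn; lia. Qed.

Lemma threshold (p : pred nat) n : (forall j, p j.+1 -> p j) -> ~~ p n ->
  exists2 w, w <= n & forall j, p j = (j < w).
Proof.
move=> anti np; have ex : exists j, ~~ p j by exists n.
have antiD j d : p (j + d) -> p j.
  by elim: d => [|d IHd]; rewrite ?addn0 // addnS => /anti.
case: (ex_minnP ex) => w npw minw; exists w; first exact: minw.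
move=> j; case: (ltnP j w) => [lt|le].
  by apply: contraTT lt => npj; rewrite -leqNgt minw.
by apply: contraNF npw; rewrite -(subnKC le); apply: antiD.
Qed.

Lemma sum_hook m h n : 0 < h <= m -> h <= n -> \sum_(i < n) hook m h i = m.
Proof.
case: n => [|n] hm hn; first by lia.
rewrite big_ord_recl /= (eq_bigr (fun i : 'I_n => nat_of_bool (i < h.-1))).
  by rewrite sum_ltn {1}/hook /=; lia.
by move=> i _; rewrite /hook /bump /=; lia.
Qed.

Lemma hookS m h i : hook m h i.+1 <= 1.
Proof. by rewrite /hook /=; case: ltnP. Qed.

Lemma hook_gt0 m h i : h <= m -> (0 < hook m h i) = (i < h) || (i == 0).
Proof. by rewrite /hook; case: eqP => //=; lia. Qed.

Section HookStrip.
Variables m1 m2 h i0 i1 : nat.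
Hypothesis fits : strip_fits m1 m2 h i0 i1.
Local Notation mu := (hook m1 h).
Local Notation lam := (hook_strip m1 m2 h i0 i1).

Lemma hook_strip_gt i : (mu i < lam i) = (i0 <= i <= i1).
Proof.
case/and5P: fits => h0 hm i01 lt _; rewrite /hook_strip.
case: ifP => [|out]; first by lia.
case: eqP => [->|ne]; first by lia.
by rewrite ltnS hook_anti; lia.
Qed.

Lemma hook_strip_ge i : mu i <= lam i.
Proof.
have := hook_strip_gt i; rewrite /hook_strip; case: ifP; lia.
Qed.

(** This is the absence of 2 x 2 blocks in the strip. *)
Lemma hook_stripS i : lam i.+1 <= (mu i).+1.
Proof.
case/and5P: fits => h0 hm i01 lt top; rewrite /hook_strip.
have := @hook_anti m1 h i i.+1 hm (leqnSn i).
case: ifP => [|out]; first by lia.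
case: eqP => [e|ne] //=; move: top; rewrite -e /=; lia.
Qed.

Lemma hook_strip_anti i : lam i.+1 <= lam i.
Proof.
have := hook_stripS i; have := hook_strip_gt i.
case: (boolP (i0 <= i <= i1)) => [|out]; first by lia.
case/and5P: fits => h0 hm i01 lt top _ _.
have a1 := @hook_anti m1 h i i.+1 hm (leqnSn i).
rewrite /hook_strip; have -> : (i < i0) || (i1 < i) by lia.
case: ifP => // out'; case: eqP => [e|]; last by lia.
by move: top; rewrite -e.
Qed.

Lemma hook_strip_top : lam i0 = strip_top m1 m2 h i0 i1.
Proof. by rewrite /hook_strip ltnn eqxx; case/and5P: fits => _ _ i01 _ _;
  rewrite ltnNge i01. Qed.

(** In a lower row of the strip the last cell lies below another cell of the strip, so only the end
    of the top row is a corner. *)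
Lemma hook_strip_corner i :
  (mu i < lam i) && ((i == 0) || (lam i <= mu i.-1)) = (i == i0).
Proof.
case/and5P: (fits) => h0 hm i01 lt top; rewrite hook_strip_gt.
case: (eqVneq i i0) => [->|ne]; first by rewrite hook_strip_top leqnn i01.
apply/negbTE; rewrite negb_and; case: (boolP (i0 <= i <= i1)) => //= inn.
rewrite /hook_strip; have -> : (i < i0) || (i1 < i) = false by lia.
by rewrite (negbTE ne) /=; lia.
Qed.

Lemma sum_hook_strip n : i1 < n -> \sum_(i < n) (lam i - mu i) = m2.
Proof.
move=> i1n; case/and5P: (fits) => h0 hm i01 lt _.
(* The partial sums telescope: [minn n.-1 i1] is the last strip row among the first [n] rows, and
   its old length is the term not yet cancelled. *)
have: \sum_(i < n) (lam i - mu i) + (if n <= i0 then 0 else mu (minn n.-1 i1)) =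
    if n <= i0 then 0 else strip_top m1 m2 h i0 i1 + (minn n.-1 i1 - i0).
  elim: n {i1n} => [|n IHn]; first by rewrite big_ord0.
  rewrite big_ord_recr /=; move: IHn; have := hook_strip_gt n; have := hook_strip_ge n.
  case: (ltngtP n i0) => [lt0|gt0|e] /=.
  - by lia.
  - case: (boolP (n <= i1)) => n1 /=; last first.
      have -> : minn n.-1 i1 = i1 by lia.
      have -> : minn n i1 = i1 by lia.
      lia.
    have -> : minn n.-1 i1 = n.-1 by lia.
    have -> : minn n i1 = n by lia.
    have -> : lam n = (mu n.-1).+1.
      rewrite /hook_strip; have -> : (n < i0) || (i1 < n) = false by lia.
      by have -> : (n == i0) = false by lia.
    have := hook_anti hm (leq_pred n); lia.
  - have -> : minn n i1 = n by lia.
    by rewrite !e hook_strip_top; lia.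
rewrite leqNgt; have -> : i0 < n by lia.
have -> /= : minn n.-1 i1 = i1 by lia.
by move: lt; rewrite /strip_top; lia.
Qed.

Lemma hook_strip_bounds : i1 < m1 + m2 /\ forall i, lam i <= m1 + m2.
Proof.
case/and5P: (fits) => h0 hm i01 lt top.
(* A strip starting below the first row needs a nonempty row above it. *)
have i0h : i0 <= h by move: top lt; rewrite /hook; case: (i0) => [|[|i]] /=; lia.
have lt1 := hook_anti hm i01.
have m2_gt0 : i1 - i0 < m2 by move: lt; rewrite /strip_top; lia.
split; first by lia.
have mu_le i : mu i <= m1 by rewrite /hook; case: eqP; lia.
move=> i; have := hook_anti hm (leq0n i); rewrite /hook_strip.
have := mu_le i; have := mu_le i1; have := mu_le i.-1.
case: ifP => [|_]; first by lia.
by case: ifP => _; rewrite /strip_top; lia.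
Qed.

End HookStrip.

(** * Arrays with one or two corners *)

(* The cells whose overlining is a free choice, respectively impossible. *)
Definition corner (E : nat -> nat -> nat) (i j : nat) : bool :=
  [&& 0 < E i j, E i j.+1 != E i j & (i == 0) || (E i.-1 j != E i j)].

Definition clash (E : nat -> nat -> nat) (i j : nat) : bool :=
  [&& 0 < E i j, E i j.+1 == E i j, 0 < i & E i.-1 j == E i j].

Definition two_level (a b : nat) (mu lam : nat -> nat) (i j : nat) : nat :=
  if j < mu i then a else if j < lam i then b else 0.

Lemma sum_two_level a b mu lam n i : mu i <= lam i -> lam i <= n ->
  \sum_(j < n) two_level a b mu lam i j = a * mu i + b * (lam i - mu i).
Proof.
move=> le1 le2.
rewrite (eq_bigr (fun j : 'I_n => a * (j < mu i) + b * ((j < lam i) - (j < mu i)))).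
  rewrite big_split -!big_distrr sumnB /=; last by move=> j _; lia.
  by rewrite !sum_ltn (minn_idPr le2) (minn_idPr (leq_trans le1 le2)).
by move=> j _; rewrite /two_level; case: ltnP; case: ltnP; lia.
Qed.

Section TwoLevel.
Variables (a b : nat) (mu lam : nat -> nat).
Hypotheses (b_gt0 : 0 < b) (lt_ba : b < a).
Hypotheses (mu_anti : forall i, mu i.+1 <= mu i) (mu_hook : forall i, mu i.+1 <= 1).
Hypotheses (lam_anti : forall i, lam i.+1 <= lam i) (mu_lam : forall i, mu i <= lam i).
Hypothesis lam_strip : forall i, lam i.+1 <= (mu i).+1.
Local Notation G := (two_level a b mu lam).

Lemma two_level_row i j : G i j.+1 <= G i j.
Proof.
have := mu_lam i; rewrite /two_level.
by case: (ltnP j.+1 (mu i)); case: (ltnP j (mu i));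
  case: (ltnP j.+1 (lam i)); case: (ltnP j (lam i)); lia.
Qed.

Lemma two_level_col i j : G i.+1 j <= G i j.
Proof.
have := mu_lam i; have := mu_lam i.+1; have := mu_anti i; have := lam_anti i.
rewrite /two_level.
by case: (ltnP j (mu i.+1)); case: (ltnP j (mu i));
  case: (ltnP j (lam i.+1)); case: (ltnP j (lam i)); lia.
Qed.

(** A clash spans a constant 2 x 2 block: at level [a] this contradicts [mu_hook], at level [b] it
    contradicts [lam_strip]. *)
Lemma two_level_clash i j : ~~ clash G i j.
Proof.
case: i => [|i]; first by rewrite /clash /= andbF andbF.
have := mu_lam i; have := mu_lam i.+1; have := mu_anti i; have := lam_anti i.
have := mu_hook i; have := lam_strip i.
rewrite /clash /= /two_level.
by case: (ltnP j.+1 (mu i.+1)); case: (ltnP j (mu i.+1)); case: (ltnP j (mu i));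
 case: (ltnP j.+1 (lam i.+1)); case: (ltnP j (lam i.+1)); case: (ltnP j (lam i)); lia.
Qed.

(** The cells of the hook below the first row repeat the value above them; a row of the strip ends
    in a corner unless its last cell lies below the strip. *)
Lemma two_level_corner i j : corner G i j =
  ((i == 0) && (j.+1 == mu 0)) ||
  [&& j.+1 == lam i, mu i < lam i & (i == 0) || (lam i <= mu i.-1)].
Proof.
case: i => [|i].
  have := mu_lam 0; rewrite /corner /= /two_level.
  by case: (ltnP j.+1 (mu 0)); case: (ltnP j (mu 0));
   case: (ltnP j.+1 (lam 0)); case: (ltnP j (lam 0)); lia.
have := mu_lam i; have := mu_lam i.+1; have := mu_anti i; have := lam_anti i.
have := mu_hook i; have := lam_strip i.
rewrite /corner /= /two_level.
by case: (ltnP j.+1 (mu i.+1)); case: (ltnP j (mu i.+1)); case: (ltnP j (mu i));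
 case: (ltnP j.+1 (lam i.+1)); case: (ltnP j (lam i.+1)); case: (ltnP j (lam i)); lia.
Qed.

End TwoLevel.

(** * Arrays with a single positive value *)

Section OneLevel.
Variables (v : nat) (mu : nat -> nat).
Hypothesis v_gt0 : 0 < v.
Hypotheses (mu_anti : forall i, mu i.+1 <= mu i) (mu_hook : forall i, mu i.+1 <= 1).
Local Notation G := (two_level v 0 mu mu).

Lemma one_level_row i j : G i j.+1 <= G i j.
Proof. by rewrite /two_level; case: (ltnP j (mu i)); case: (ltnP j.+1 (mu i)); lia. Qed.

Lemma one_level_col i j : G i.+1 j <= G i j.
Proof.
have := mu_anti i; rewrite /two_level.
by case: (ltnP j (mu i.+1)); case: (ltnP j (mu i)); lia.
Qed.

Lemma one_level_clash i j : ~~ clash G i j.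
Proof.
case: i => [|i]; first by rewrite /clash /= andbF andbF.
have := mu_anti i; have := mu_hook i; rewrite /clash /= /two_level.
by case: (ltnP j.+1 (mu i.+1)); case: (ltnP j (mu i.+1)); case: (ltnP j (mu i)); lia.
Qed.

Lemma one_level_corner i j : corner G i j = (i == 0) && (j.+1 == mu 0).
Proof.
case: i => [|i].
  by rewrite /corner /= /two_level; case: (ltnP j.+1 (mu 0)); case: (ltnP j (mu 0)); lia.
have := mu_anti i; have := mu_hook i; rewrite /corner /= /two_level.
by case: (ltnP j.+1 (mu i.+1)); case: (ltnP j (mu i.+1)); case: (ltnP j (mu i)); lia.
Qed.

End OneLevel.

(** * Recovering the hook and the strip from the corners *)

Section Classification.
Variables (E : nat -> nat -> nat) (N : nat).
Hypothesis bounded : forall i j, N <= j -> E i j = 0.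

(** Walk right or up while the value stays the same; [i + (N - j)] decreases, and [bounded] stops
    the walk to the right. *)
Lemma corner_of_value i j : 0 < E i j ->
  exists i' j', corner E i' j' /\ E i' j' = E i j.
Proof.
move: {2}(i + (N - j)) (leqnn (i + (N - j))) => n.
elim: n i j => [|n IHn] i j le Eij; have jN : j < N.
- by rewrite ltnNge; apply/negP => /(bounded i); lia.
- by lia.
- by rewrite ltnNge; apply/negP => /(bounded i); lia.
case: (boolP (corner E i j)) => [|nc]; first by exists i, j.
move: nc; rewrite /corner Eij /= negb_and negbK => /orP[/eqP e|].
  by rewrite -e; apply: IHn; rewrite ?e //; lia.
rewrite negb_or negbK => /andP[i0 /eqP e].
by rewrite -e; apply: IHn; rewrite ?e //; lia.
Qed.

Hypothesis row : forall i j, E i j.+1 <= E i j.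
Hypothesis col : forall i j, E i.+1 j <= E i j.
Hypothesis five_rows : forall i j, 5 <= i -> E i j = 0.
Hypothesis no_clash : forall i j, ~~ clash E i j.
Hypothesis E00 : 0 < E 0 0.

Lemma le_E00 i j : E i j <= E 0 0.
Proof.
elim: i => [|i IHi]; last exact: leq_trans (col i j) IHi.
by elim: j => // j IHj; apply: leq_trans (row 0 j) IHj.
Qed.

(** Since [E] decreases along rows, this is the length of row [i] in the region of entries at least
    [v]. *)
Definition width v i : nat := \sum_(j < N) (v <= E i j).

Lemma widthE v i j : 0 < v -> (v <= E i j) = (j < width v i).
Proof.
move=> v0; have [||w wN wP] := @threshold (fun j => v <= E i j) N.
- by move=> k /leq_trans; apply; apply: row.
- by rewrite bounded // -ltnNge.
rewrite wP /width (eq_bigr (fun j : 'I_N => nat_of_bool (j < w))).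
  by rewrite sum_ltn (minn_idPr wN).
by move=> k _; rewrite wP.
Qed.

Lemma width_anti v i : 0 < v -> width v i.+1 <= width v i.
Proof. by move=> v0; apply: leq_sum => j _; have := col i j; lia. Qed.

Lemma width_five v i : 0 < v -> 5 <= i -> width v i = 0.
Proof. by move=> v0 i5; rewrite /width big1 // => j _; rewrite five_rows //; lia. Qed.

Local Notation a := (E 0 0).
Local Notation mu := (width (E 0 0)).

(** Two maximal entries in a row below the first would give a clash in column 0, so these rows
    contain at most one. *)
Lemma width_top_hook : exists m h, [/\ 0 < h, h <= 5, h <= m & forall i, mu i = hook m h
  i].
Proof.
have mu1 i : mu i.+1 <= 1.
  rewrite leqNgt; apply/negP => gt; have := no_clash i.+1 0.
  have e1 : a <= E i.+1 1 by rewrite widthE.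
  by have := le_E00 i.+1 1; have := row i.+1 0; have := le_E00 i 0; have := col i 0;
    rewrite /clash /=; lia.
have mu0 : 0 < mu 0 by rewrite -widthE.
have [||h h5 hP] := @threshold (fun i => 0 < mu i) 5.
- by move=> k /leq_trans; apply; apply: width_anti.
- by rewrite width_five.
have h0 : 0 < h by rewrite -hP.
exists (mu 0 + h.-1), h; split => //; first by lia.
case=> [|i]; rewrite /hook /=; first by lia.
by have := mu1 i; have := hP i.+1; lia.
Qed.

Lemma corner_top : corner E 0 (mu 0).-1.
Proof.
have mu0 : 0 < mu 0 by rewrite -widthE.
have := widthE 0 (mu 0).-1 E00; have := widthE 0 (mu 0) E00.
rewrite /corner prednK //; have := le_E00 0 (mu 0).-1; lia.
Qed.

(** Every positive value occurs at a corner, and the only corner carries the maximal value. *)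
Lemma one_corner_shape i' j' : (forall i j, corner E i j -> (i, j) = (i', j')) ->
  exists v m h, [/\ 0 < v, 0 < h, h <= 5, h <= m &
    forall i j, E i j = two_level v 0 (hook m h) (hook m h) i j].
Proof.
move=> uniq; have [m [h [h0 h5 hm muE]]] := width_top_hook.
exists a, m, h; split=> // i j; rewrite /two_level -muE -widthE //.
have le := le_E00 i j; case: ifP => [|lt]; first by lia.
rewrite if_same; case: (posnP (E i j)) => // pos;
  have [k [l [kl e]]] := corner_of_value pos.
have := uniq _ _ corner_top; rewrite -(uniq _ _ kl) => -[ek el].
rewrite -ek -el in e; have := widthE 0 (mu 0).-1 E00; rewrite e lt.
by have : 0 < mu 0; [rewrite -widthE | lia].
Qed.


Section TwoCorners.
Variables (i0 j0 : nat).
Hypothesis other : (i0, j0) != (0, (mu 0).-1).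
Hypothesis corner0 : corner E i0 j0.
Hypothesis corner_uniq : forall i j,
  corner E i j -> (i, j) = (0, (mu 0).-1) \/ (i, j) = (i0, j0).

Local Notation b := (E i0 j0).
Local Notation lam := (width (E i0 j0)).

Lemma second_value_gt0 : 0 < b.
Proof. by case/and3P: corner0. Qed.

(** A corner with the maximal value lies in row 0, as the entry above it would be maximal too; there
    it ends the run of maximal entries, which [other] excludes. *)
Lemma second_value_lt : b < a.
Proof.
have b0 := second_value_gt0; rewrite ltn_neqAle le_E00 andbT; apply/negP => /eqP e.
case/and3P: corner0 => _ ne up; case: (posnP i0) => i00.
  move: other; rewrite i00 => /eqP[]; congr pair.
  have := widthE 0 j0 E00; have := widthE 0 j0.+1 E00; have := row 0 j0.
  by move: e ne; rewrite i00; lia.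
have := col i0.-1 j0; rewrite prednK //; have := le_E00 i0.-1 j0; lia.
Qed.

Lemma two_values i j : [\/ E i j = 0, E i j = a | E i j = b].
Proof.
case: (posnP (E i j)) => [|pos]; first by constructor 1.
have [k [l [kl e]]] := corner_of_value pos.
case: (corner_uniq kl) => -[ek el]; last by rewrite -e ek el; constructor 3.
constructor 2; rewrite -e ek el.
have := widthE 0 (mu 0).-1 E00; have := le_E00 0 (mu 0).-1.
by have : 0 < mu 0; [rewrite -widthE | lia].
Qed.

Lemma two_levelE i j : E i j = two_level a b mu lam i j.
Proof.
have b0 := second_value_gt0; have ba := second_value_lt.
rewrite /two_level -!widthE //; have le := le_E00 i j.
case: ifP => [|lt]; first by lia.
by case: (two_values i j) => e; case: ifP; lia.
Qed.

Lemma mu_le_lam i : mu i <= lam i.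
Proof. by apply: leq_sum => j _; have := second_value_lt; lia. Qed.

(** Otherwise [b] stands in columns [j] and [j.+1] of row [i.+1] and in column [j] of row [i], for
    [j = lam i.+1 - 2]: a clash. *)
Lemma lam_le_mu i : lam i.+1 <= (mu i).+1.
Proof.
have b0 := second_value_gt0; rewrite leqNgt; apply/negP => gt.
have := no_clash i.+1 (lam i.+1 - 2).
have m1 := width_anti i E00; have m2 := width_anti i b0.
rewrite /clash /=; set j := lam i.+1 - 2.
have e1 : E i.+1 j = b by rewrite two_levelE /two_level; do 2?case: ifP; lia.
have e2 : E i.+1 j.+1 = b by rewrite two_levelE /two_level; do 2?case: ifP; lia.
have e3 : E i j = b by rewrite two_levelE /two_level; do 2?case: ifP; lia.
by rewrite e1 e2 e3 b0 eqxx.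
Qed.

(** If the last strip cell of a row does not lie below the strip, it is a corner, and it must then
    be [(i0, j0)]. *)
Lemma lam_corner i :
  (mu i < lam i) && ((i == 0) || (lam i <= mu i.-1)) = (i == i0).
Proof.
have b0 := second_value_gt0; have ba := second_value_lt.
apply/andP/eqP => [[lt top]|->].
  have := @corner_uniq i (lam i).-1; case.
  - have e1 : E i (lam i).-1 = b.
      by rewrite two_levelE /two_level; do 2?case: ifP; lia.
    have e2 : E i (lam i) = 0.
      by rewrite two_levelE /two_level; do 2?case: ifP; lia.
    rewrite /corner prednK ?e1 ?e2 ?b0; last by lia.
    case/orP: top => [->|top]; first by lia.
    have e3 : E i.-1 (lam i).-1 = a by rewrite two_levelE /two_level; case: ifP; lia.
    by rewrite e3; lia.
  - case=> i00 e; move: lt; rewrite i00 in e *.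
    have : 0 < mu 0 by rewrite -widthE.
    by lia.
  - by case.
have e1 := widthE i0 j0 b0; have e2 := widthE i0 j0 E00.
have e3 := widthE i0 j0.+1 b0; have := row i0 j0.
case/and3P: corner0 => _ ne up.
split; first by lia.
case: (posnP i0) => //= i00; move: up; rewrite gtn_eqF //= => up.
have := col i0.-1 j0; rewrite prednK // => le.
have := widthE i0.-1 j0 E00.
by case: (two_values i0.-1 j0); lia.
Qed.

(** A strip row other than [i0] has a strip row directly above it, for otherwise it would end in a
    third corner. Hence the strip rows form an interval starting at [i0]. *)
Lemma strip_rows : exists2 i1, i1 < 5 & forall i, (mu i < lam i) = (i0 <= i <= i1).
Proof.
have b0 := second_value_gt0.
have step i : i != i0 -> mu i < lam i -> 0 < i /\ mu i.-1 < lam i.-1.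
  move=> ne lt; have := lam_corner i; rewrite (negbTE ne) lt /=.
  case: i ne lt => // i ne lt /= top; split=> //.
  by have := width_anti i b0; lia.
have lo i : mu i < lam i -> i0 <= i.
  elim: i => [|i IHi] lt; case: (eqVneq i0 0) => [-> //|ne0].
    by have [] := step 0; rewrite // eq_sym.
  case: (eqVneq i.+1 i0) => [<- //|ne]; have [_ /IHi] := step _ ne lt; lia.
have [||d d5 dP] := @threshold (fun d => mu (i0 + d) < lam (i0 + d)) 5.
- move=> d; rewrite addnS => lt; have [] := step (i0 + d).+1 => //; lia.
- by rewrite !width_five //; lia.
have d0 : 0 < d.
  by rewrite -dP addn0; have := lam_corner i0; rewrite eqxx => /andP[].
have inP i : (mu i < lam i) = (i0 <= i <= i0 + d.-1).
  case: (leqP i0 i) => [le|gt].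
    by have := dP (i - i0); rewrite subnKC //; lia.
  by apply/negP => /lo; lia.
exists (i0 + d.-1) => //; rewrite ltnNge; apply/negP => ge5.
by have := inP (i0 + d.-1); rewrite !width_five //; lia.
Qed.

Lemma two_corner_shape : exists m1 m2 h i1, [/\ h <= 5, i1 < 5,
  strip_fits m1 m2 h i0 i1 &
  forall i j, E i j = two_level a b (hook m1 h) (hook_strip m1 m2 h i0 i1) i j].
Proof.
have b0 := second_value_gt0.
have [m [h [h0 h5 hm muE]]] := width_top_hook; have [i1 i15 i1P] := strip_rows.
have /andP[lt0 top] : (mu i0 < lam i0) && ((i0 == 0) || (lam i0 <= mu i0.-1)).
  by rewrite lam_corner.
have i01 : i0 <= i1 by have := i1P i0; lia.
have a01 := hook_anti hm i01.
(* Solves the definition of [strip_top] for the top row length [lam i0]. *)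
pose m2 := lam i0 + (i1 - i0) - mu i1.
have topE : strip_top m m2 h i0 i1 = lam i0.
  by rewrite /strip_top /m2; move: lt0; rewrite !muE; lia.
exists m, m2, h, i1; split => //.
  by rewrite /strip_fits topE h0 hm i01 -!muE lt0 top.
move=> i j; rewrite two_levelE /two_level -muE.
suff -> : hook_strip m m2 h i0 i1 i = lam i by [].
rewrite /hook_strip topE; case: ifP => out.
  by rewrite -muE; have := i1P i; have := mu_le_lam i; lia.
case: eqP => [-> //|/eqP ne]; rewrite -muE.
(* Below row [i0] the row does not end in a corner, so [lam i > mu i.-1]; with [lam_le_mu] this
   determines [lam i]. *)
have := lam_corner i; rewrite (negbTE ne) i1P; have -> /= : i0 <= i <= i1 by lia.
by case: i ne out => // i ne out /=; have := lam_le_mu i; lia.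
Qed.

End TwoCorners.

End Classification.

(** * Overlinings modulo 8 *)

Section Markings.
Variables (T A : finType).
Implicit Types (s : {ffun T -> A * bool}) (e : {ffun T -> A}).

Definition unmark s : {ffun T -> A} := [ffun x => (s x).1].
(** The empty marking lets the predicates on marked objects be applied to unmarked ones. *)
Definition mark0 e : {ffun T -> A * bool} := [ffun x => (e x, false)].

(** Over a fixed underlying function the overlinings are chosen independently at each point. *)
Lemma card_marked (Q : pred {ffun T -> A}) (ok : {ffun T -> A} -> T -> bool -> bool) :
  #|[set s | Q (unmark s) && [forall x, ok (unmark s) x (s x).2]]| =
  \sum_(e | Q e) \prod_x (ok e x true + ok e x false).
Proof.
rewrite -sum1_card (partition_big unmark Q) /=; last by move=> s; rewrite inE => /andP[].
apply: eq_bigr => e Qe.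
transitivity #|family (fun x => [pred y : A * bool | (y.1 == e x) && ok e x y.2])|.
  rewrite sum1_card; apply: eq_card => s.
  rewrite [LHS]unfold_in /= inE.
  apply/andP/familyP => [[/andP[_ /forallP oks] /eqP ue] x|fam].
    by rewrite inE; have := oks x; rewrite ue => ->; rewrite -ue ffunE eqxx.
  have ue : unmark s = e.
    by apply/ffunP => x; rewrite ffunE; have := fam x; rewrite inE => /andP[/eqP].
  rewrite ue Qe eqxx; split=> //; apply/forallP => x.
  by have := fam x; rewrite inE => /andP[].
rewrite card_family foldrE big_map big_enum /=; apply: eq_bigr => x _.
rewrite -sum1_card (eq_bigl (fun y : A * bool => (y.1 == e x) && ok e x y.2)) //.
rewrite -(pair_big_dep (pred1 (e x)) (fun _ => ok e x) (fun _ _ => 1)) /= big_pred1_eq.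
by rewrite big_mkcond big_bool; case: (ok e x true); case: (ok e x false).
Qed.

End Markings.

(** A nonzero product is 2 to the number of points in [C e]; this number is positive, and from 3 on
    the product vanishes modulo 8. *)
Lemma sum_weights_mod8 (X T : finType) (D : pred X) (C Z : X -> pred T) :
  (forall e, D e -> 0 < #|C e|) ->
  \sum_(e | D e) \prod_x (if C e x then 2 else if Z e x then 0 else 1) =
  2 * #|[set e | [&& D e, [forall x, ~~ Z e x || C e x] & #|C e| == 1]]|
  + 4 * #|[set e | [&& D e, [forall x, ~~ Z e x || C e x] & #|C e| == 2]]| %[mod 8].
Proof.
move=> C0; have cardE k c : k * #|[set e | [&& D e, [forall x, ~~ Z e x || C e x] & #|C
  e| == c]]| =
    \sum_(e | D e) (if [forall x, ~~ Z e x || C e x] && (#|C e| == c) then k else 0).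
  rewrite -sum1_card big_distrr /= big_mkcond [RHS]big_mkcond; apply: eq_bigr => e _.
  by rewrite inE muln1; case: (D e).
rewrite !cardE -big_split /=.
apply: (big_ind2 (fun u v => u = v %[mod 8])) => //.
  by move=> u u' v v' h h'; rewrite -modnDm h h' modnDm.
move=> e De; case: (boolP [forall x, _]) => [/forallP nZ|].
  have -> : \prod_x (if C e x then 2 else if Z e x then 0 else 1) = 2 ^ #|C e|.
    rewrite -prod_nat_const [RHS]big_mkcond; apply: eq_bigr => x _.
    rewrite unfold_in; have := nZ x; case: (C e x) => //; rewrite orbF.
    by case: (Z e x).
  move: (C0 _ De); case: #|_| => [|[|[|k]]] //= _.
  by rewrite !expnS !mulnA modnMr.
rewrite negb_forall => /existsP[x]; rewrite negb_or negbK => /andP[Zx /negbTE Cx].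
by rewrite (bigD1 x) //= Cx Zx.
Qed.

Section Arrays.
Variable n : nat.
Local Notation N := n.+1.
Local Notation array := {ffun 'I_N * 'I_N -> 'I_N.+1}.
Implicit Types (e : array) (s : marked_array N).

(** Extension by zero makes the results for arrays on all pairs of naturals available. *)
Definition ext e (i j : nat) : nat :=
  if (i < N) && (j < N) then nat_of_ord (e (inord i, inord j)) else 0.

Lemma ext_ord e (i j : 'I_N) : ext e i j = e (i, j).
Proof. by rewrite /ext !ltn_ord !inord_val. Qed.

Lemma ext_row_out e i j : N <= i -> ext e i j = 0.
Proof. by rewrite /ext leqNgt => /negbTE ->. Qed.

Lemma ext_col_out e i j : N <= j -> ext e i j = 0.
Proof. by rewrite /ext andbC leqNgt => /negbTE ->. Qed.

Lemma ext_inj e e' : (forall i j, ext e i j = ext e' i j) -> e = e'.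
Proof. by move=> h; apply/ffunP => -[i j]; apply/val_inj; have := h i j;
  rewrite !ext_ord. Qed.

Definition truncate (G : nat -> nat -> nat) : array :=
  [ffun x : 'I_N * 'I_N => inord (G x.1 x.2)].

Lemma ext_truncate (G : nat -> nat -> nat) :
  (forall i j, G i j <= N) -> (forall i j, N <= i -> G i j = 0) ->
  (forall i j, N <= j -> G i j = 0) ->
  forall i j, ext (truncate G) i j = G i j.
Proof.
move=> GN Gi Gj i j; rewrite /ext; case: (ltnP i N) => [iN|/Gi -> //].
by case: (ltnP j N) => [jN|/Gj -> //]; rewrite ffunE /= !inordK // ltnS.
Qed.

Definition admissible e : bool :=
  is_plane_partition (mark0 e) && (num_rows (mark0 e) <= 5).

Lemma entry_mark0 e (i j : 'I_N) : entry (mark0 e) i j = ext e i j.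
Proof. by rewrite /entry ffunE ext_ord. Qed.

Lemma sum_ext e : \sum_(i < N) \sum_(j < N) entry (mark0 e) i j =
  \sum_(i < N) \sum_(j < N) ext e i j.
Proof. by apply: eq_bigr => i _; apply: eq_bigr => j _; rewrite entry_mark0. Qed.

Lemma admissibleP e : reflect
  [/\ forall i j, ext e i j.+1 <= ext e i j, forall i j, ext e i.+1 j <= ext e i j,
      \sum_(i < N) \sum_(j < N) ext e i j = N
    & forall i j, 5 <= i -> ext e i j = 0] (admissible e).
Proof.
rewrite /admissible /is_plane_partition sum_ext.
apply: (iffP idP) => [/andP[/and3P[/forallP rows /forallP cols /eqP sum] five]|[rows cols
  sum five]].
  have rowsP i j : ext e i j.+1 <= ext e i j.
    case: (ltnP j.+1 N) => [j1|/ext_col_out -> //].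
    case: (ltnP i N) => [i1|/ext_row_out -> //].
    have /forallP/(_ (Ordinal (ltnW j1)))/forallP/(_ (Ordinal j1))/implyP := rows
      (Ordinal i1).
    by rewrite !entry_mark0 /=; apply.
  have colsP i j : ext e i.+1 j <= ext e i j.
    case: (ltnP i.+1 N) => [i1|/ext_row_out -> //].
    case: (ltnP j N) => [j1|/ext_col_out -> //].
    have /forallP/(_ (Ordinal (ltnW i1)))/forallP/(_ (Ordinal i1))/implyP := cols
      (Ordinal j1).
    by rewrite !entry_mark0 /=; apply.
  split=> // i j i5; apply/eqP; rewrite -leqn0.
  have le0 k : ext e i k <= ext e i 0.
    by elim: k => // k IHk; apply: leq_trans (rowsP i k) IHk.
  apply: leq_trans (le0 j) _; rewrite leqNgt; apply/negP => pos.
  have iN : i < N by rewrite ltnNge; apply/negP => /(ext_row_out e 0) h; rewrite h in pos.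
  have antiD k d : ext e (k + d) 0 <= ext e k 0.
    by elim: d => [|d IHd]; rewrite ?addn0 // addnS; apply: leq_trans (colsP _ _) IHd.
  move: five; rewrite leqNgt => /negP; apply.
  (* A nonzero row [i >= 5] makes rows 0 to [i] all nonzero, which is at least six rows. *)
  have sub : [set k : 'I_N | k < i.+1] \subset
      [set k : 'I_N | [exists l : 'I_N, 0 < entry (mark0 e) k l]].
    apply/subsetP => k; rewrite !inE => ki; apply/existsP; exists ord0.
    rewrite entry_mark0; apply: leq_trans pos _.
    by have := antiD k (i - k); rewrite subnKC.
  apply: leq_trans (subset_leq_card sub).
  rewrite -sum1_card big_mkcond (eq_bigr (fun k : 'I_N => nat_of_bool (k < i.+1))).
    by rewrite sum_ltn; lia.
  by move=> k _; rewrite inE.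
have rowD i j d : ext e i (j + d) <= ext e i j.
  by elim: d => [|d IHd]; rewrite ?addn0 // addnS; apply: leq_trans (rows _ _) IHd.
have colD i j d : ext e (i + d) j <= ext e i j.
  by elim: d => [|d IHd]; rewrite ?addn0 // addnS; apply: leq_trans (cols _ _) IHd.
apply/andP; split; first apply/and3P; first split.
- apply/forallP => i; apply/forallP => j1; apply/forallP => j2; apply/implyP => le.
  by rewrite !entry_mark0 -(subnKC le).
- apply/forallP => j; apply/forallP => i1; apply/forallP => i2; apply/implyP => le.
  by rewrite !entry_mark0 -(subnKC le).
- exact/eqP.
have sub : [set k : 'I_N | [exists l : 'I_N, 0 < entry (mark0 e) k l]] \subset
    [set k : 'I_N | k < 5].
  apply/subsetP => k; rewrite !inE => /existsP[l]; rewrite entry_mark0 => pos.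
  by rewrite ltnNge; apply/negP => /five h; rewrite h in pos.
apply: leq_trans (subset_leq_card sub) _.
rewrite -sum1_card big_mkcond (eq_bigr (fun k : 'I_N => nat_of_bool (k < 5))).
  by rewrite sum_ltn; lia.
by move=> k _; rewrite inE.
Qed.

Definition overline_ok e (x : 'I_N * 'I_N) (o : bool) : bool :=
  let v := e x : nat in
  [&& (v == 0) ==> ~~ o,
      ((0 < v) && [exists j : 'I_N, (x.2 < j) && (e (x.1, j) == v :> nat)]) ==> ~~ o
    & ((0 < v) && [exists i : 'I_N, (i < x.1) && (e (i, x.2) == v :> nat)]) ==> o].

Lemma plbar_sum : plbar 5 N = \sum_(e | admissible e)
  \prod_x (overline_ok e x true + overline_ok e x false).
Proof.
rewrite /plbar -card_marked; apply: eq_card => s; rewrite !inE.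
have es i j : entry s i j = entry (mark0 (unmark s)) i j by rewrite /entry !ffunE.
have eu x : unmark s x = (s x).1 by rewrite ffunE.
have -> : num_rows s = num_rows (mark0 (unmark s)).
  apply: eq_card => i; rewrite !inE; apply: eq_existsb => j.
  by rewrite es.
have pp : is_plane_partition s = is_plane_partition (mark0 (unmark s)).
  congr [&& _, _ & _].
  - by do 3!apply: eq_forallb => ?; rewrite !es.
  - by do 3!apply: eq_forallb => ?; rewrite !es.
  - by congr (_ == _); do 2!apply: eq_bigr => ? _; rewrite es.
have shuffle (p r f q : bool) : q = f -> p && q && r = (p && r) && f.
  by move=> ->; case: p; case: r; rewrite ?andbF ?andbT.
rewrite /admissible -pp; apply: shuffle.
apply/and3P/forallP => [[/forallP z /forallP r /forallP c] [i j]|ok].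
  have := forallP (z i) j; have := forallP (r i) j; have := forallP (c j) i.
  rewrite /overline_ok /= !eu /entry /overlined => c' r' z'; apply/and3P; split => //.
  - move: r'; congr (_ && _ ==> _); apply: eq_existsb => k; rewrite ?eu //.
  - move: c'; congr (_ && _ ==> _); apply: eq_existsb => k; rewrite ?eu //.
split; apply/forallP => i; apply/forallP => j.
- by have /and3P[+ _ _] := ok (i, j); rewrite /= !eu.
- have /and3P[_ + _] := ok (i, j); rewrite /= !eu.
  by congr (_ && _ ==> _); apply: eq_existsb => k; rewrite ?eu.
- have /and3P[_ _ +] := ok (j, i); rewrite /= !eu.
  by congr (_ && _ ==> _); apply: eq_existsb => k; rewrite ?eu.
Qed.

(** By monotonicity, an equal entry further right or further up forces equality with the adjacent
    one. An equal right neighbour forbids the overline, an equal upper neighbour requires it. *)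
Lemma overline_ok_count e x : admissible e ->
  overline_ok e x true + overline_ok e x false =
  if corner (ext e) x.1 x.2 then 2 else if clash (ext e) x.1 x.2 then 0 else 1.
Proof.
case/admissibleP => rows cols _ _; case: x => i j.
have antiR k d : ext e i (k + d) <= ext e i k.
  by elim: d => [|d IHd]; rewrite ?addn0 // addnS; apply: leq_trans (rows _ _) IHd.
have antiC k d : ext e (k + d) j <= ext e k j.
  by elim: d => [|d IHd]; rewrite ?addn0 // addnS; apply: leq_trans (cols _ _) IHd.
rewrite /overline_ok /corner /clash /= ext_ord.
case: (posnP (e (i, j))) => //= pos.
have -> : [exists k : 'I_N, (j < k) && (e (i, k) == e (i, j) :> nat)] =
    (ext e i j.+1 == e (i, j)).
  apply/existsP/eqP => [[k /andP[jk /eqP ek]]|eqE].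
    have := antiR j.+1 (k - j.+1); rewrite subnKC // ext_ord ek => le.
    by apply/eqP; rewrite eqn_leq le andbT -ext_ord.
  have jN : j.+1 < N.
    by rewrite ltnNge; apply/negP => /(ext_col_out e i) h; move: pos; rewrite -eqE h.
  by exists (Ordinal jN); rewrite /= ltnSn /= -eqE -ext_ord.
have -> : [exists k : 'I_N, (k < i) && (e (k, j) == e (i, j) :> nat)] =
    (0 < i) && (ext e i.-1 j == e (i, j)).
  apply/existsP/andP => [[k /andP[ki /eqP ek]]|[i0 /eqP eqE]].
    have i0 : 0 < i by apply: leq_ltn_trans ki.
    split=> //; rewrite eqn_leq -ek -{1}ext_ord.
    have := antiC k (i.-1 - k); rewrite subnKC; last by lia.
    move=> -> /=; rewrite ek -ext_ord.
    by have := antiC i.-1 1; rewrite addn1 prednK.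
  have iN : i.-1 < N by have := ltn_ord i; lia.
  by exists (Ordinal iN); rewrite /= prednK // leqnn /= -eqE -ext_ord.
case: (ext e i j.+1 == _) => /=; case: (posnP i) => /= i0; rewrite ?i0 //=.
  by case: (_ == _).
by case: (_ == _).
Qed.

Definition corner_at e : pred ('I_N * 'I_N) := [pred x : 'I_N * 'I_N | corner (ext e) x.1
  x.2].
Definition clash_at e : pred ('I_N * 'I_N) := [pred x : 'I_N * 'I_N | clash (ext e) x.1
  x.2].

Definition arrays_with k : {set array} :=
  [set e | [&& admissible e, [forall x, ~~ clash_at e x || corner_at e x]
             & #|corner_at e| == k]].

Lemma admissible00 e : admissible e -> 0 < ext e 0 0.
Proof.
case/admissibleP => rows cols sum _; rewrite lt0n; apply/eqP => z; move: sum.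
rewrite big1 // => i _; rewrite big1 // => j _; apply/eqP; rewrite -leqn0 -z.
exact: le_E00.
Qed.

Lemma plbar_mod8 :
  plbar 5 N = 2 * #|arrays_with 1| + 4 * #|arrays_with 2| %[mod 8].
Proof.
rewrite plbar_sum (eq_bigr (fun e => \prod_x
   (if corner_at e x then 2 else if clash_at e x then 0 else 1))).
  apply: sum_weights_mod8 => e adm; case/admissibleP: (adm) => rows cols _ _.
  have [i [j [c e1]]] := corner_of_value (@ext_col_out e) (admissible00 adm).
  have pos : 0 < ext e i j by case/and3P: c.
  have iN : i < N by rewrite ltnNge; apply/negP => /(ext_row_out e j) h; rewrite h in pos.
  have jN : j < N by rewrite ltnNge; apply/negP => /(ext_col_out e i) h; rewrite h in pos.
  by apply/card_gt0P; exists (Ordinal iN, Ordinal jN).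
by move=> e adm; apply: eq_bigr => x _; rewrite overline_ok_count.
Qed.

End Arrays.

(** * Counting arrays with one or two corners *)

Section CountArrays.
Variable n : nat.
Local Notation N := n.+1.
Local Notation K := ('I_N.+1 * 'I_N.+1)%type.
Local Notation np u := (nat_of_ord u.1, nat_of_ord u.2).
Local Notation array := {ffun 'I_N * 'I_N -> 'I_N.+1}.
Implicit Types e : array.

Lemma eq_corner E E' i j : (forall i j, E i j = E' i j) -> corner E i j = corner E' i j.
Proof. by move=> e; rewrite /corner !e. Qed.

Lemma eq_clash E E' i j : (forall i j, E i j = E' i j) -> clash E i j = clash E' i j.
Proof. by move=> e; rewrite /clash !e. Qed.

Lemma sum_strip_array a b m1 m2 h i0 i1 :
  strip_fits m1 m2 h i0 i1 -> h <= N -> i1 < N ->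
  (forall i, hook_strip m1 m2 h i0 i1 i <= N) ->
  \sum_(i < N) \sum_(j < N)
    two_level a b (hook m1 h) (hook_strip m1 m2 h i0 i1) i j = a * m1 + b * m2.
Proof.
move=> fits hN i1N lamN; case/and5P: (fits) => h0 hm _ _ _.
under eq_bigr => i _ do rewrite sum_two_level ?hook_strip_ge //.
by rewrite big_split -!big_distrr /= sum_hook ?h0 // sum_hook_strip.
Qed.

Lemma sum_hook_array v m h : 0 < h <= m -> h <= N -> m < N + h ->
  \sum_(i < N) \sum_(j < N) two_level v 0 (hook m h) (hook m h) i j = v * m.
Proof.
move=> hm hN mN; have le i : hook m h i <= N by rewrite /hook; case: eqP; lia.
under eq_bigr => i _ do rewrite sum_two_level // subnn muln0 addn0.
by rewrite -big_distrr /= sum_hook //; lia.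
Qed.

Lemma pos_lt e i j : 0 < ext e i j -> (i < N) && (j < N).
Proof. by rewrite /ext; case: ifP. Qed.

(** A clash repeats its value on the right, so it is never a corner, and a clash inside the square
    is excluded outright. *)
Lemma mem_arrays k e : e \in arrays_with n k ->
  [/\ admissible e, forall i j, ~~ clash (ext e) i j & #|[set x | corner_at e x]| = k].
Proof.
rewrite inE => /and3P[adm /forallP cl /eqP <-]; split=> //; last first.
  by apply: eq_card => x; rewrite inE.
move=> i j; apply/negP => c; have /and3P[/pos_lt /andP[iN jN] r _] := c.
have := cl (Ordinal iN, Ordinal jN); rewrite /clash_at /corner_at /= c /=.
by case/and3P=> _; rewrite r.
Qed.

(* The last component of an index is the number of rows of the hook minus one. *)
Definition hook_array (p : K * 'I_5) : array :=
  truncate n (two_level p.1.1 0 (hook p.1.2 p.2.+1) (hook p.1.2 p.2.+1)).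

Definition hook_params : {set K * 'I_5} :=
  [set p : K * 'I_5 | (p.1.1 * p.1.2 == N :> nat) && (p.2 < p.1.2)].

Lemma ext_hook_array p : p \in hook_params -> forall i j,
  ext (hook_array p) i j = two_level p.1.1 0 (hook p.1.2 p.2.+1) (hook p.1.2 p.2.+1) i j.
Proof.
case: p => -[v m] h; rewrite inE /= => /andP[/eqP vm hm].
have mN : m <= N by have := ltn_ord m; lia.
apply: ext_truncate => i j.
- by rewrite /two_level; have := ltn_ord v; case: ifP => //; case: ifP; lia.
- move=> iN; rewrite /two_level /hook; have -> : i == 0 = false by lia.
  by rewrite !if_same; have -> : i < h.+1 = false by lia.
- move=> jN; rewrite /two_level; have -> : j < hook m h.+1 i = false; last by [].
  by rewrite /hook; case: eqP; lia.
Qed.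

Lemma hook_array_mem p : p \in hook_params -> hook_array p \in arrays_with n 1.
Proof.
move=> Pp; have eG := ext_hook_array Pp; move: Pp eG.
case: p => -[v m] h; rewrite inE /= => /andP[/eqP vm hm] eG.
have v0 : 0 < v by rewrite lt0n; apply/eqP => v0; rewrite v0 in vm.
have mN : m <= N by have := ltn_ord m; lia.
have mu_anti i : hook m h.+1 i.+1 <= hook m h.+1 i by apply: hook_anti.
have mu_hook i : hook m h.+1 i.+1 <= 1 by apply: hookS.
rewrite inE; apply/and3P; split.
- apply/admissibleP; split=> [i j|i j||i j i5]; rewrite ?eG.
  + exact: one_level_row.
  + exact: one_level_col.
  + under eq_bigr => i _ do under eq_bigr => j _ do rewrite eG.
    by rewrite sum_hook_array //; lia.
  + rewrite /two_level /hook; have -> : i == 0 = false by lia.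
    by have -> : i < h.+1 = false by have := ltn_ord h; lia.
- apply/forallP => x; rewrite /clash_at /= (eq_clash _ _ eG).
  by rewrite (negbTE (one_level_clash _ _ _ _ _)).
have cN : (hook m h.+1 0).-1 < N by rewrite /hook /=; lia.
apply/eqP; apply: etrans (cards1 (ord0 : 'I_N, Ordinal cN)); apply: eq_card => -[i j].
rewrite [RHS]inE /corner_at /= unfold_in /= (eq_corner _ _ eG) one_level_corner //.
rewrite xpair_eqE -!val_eqE /=; congr (_ && _).
by have : 0 < hook m h.+1 0; [rewrite hook_gt0 | lia].
Qed.

Lemma hook_array_inj : {in hook_params &, injective hook_array}.
Proof.
move=> p p' Pp Pp' e.
have eG i j : two_level p.1.1 0 (hook p.1.2 p.2.+1) (hook p.1.2 p.2.+1) i j =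
    two_level p'.1.1 0 (hook p'.1.2 p'.2.+1) (hook p'.1.2 p'.2.+1) i j.
  by rewrite -!ext_hook_array // e.
move: p p' Pp Pp' eG {e} => [[v m] h] [[v' m'] h'].
rewrite !inE /= => /andP[/eqP vm hm] /andP[/eqP vm' hm'] eG.
have v0 : 0 < v by rewrite lt0n; apply/eqP => v0; rewrite v0 in vm.
have v0' : 0 < v' by rewrite lt0n; apply/eqP => v0'; rewrite v0' in vm'.
have muE i j : (j < hook m h.+1 i) = (j < hook m' h'.+1 i).
  by have := eG i j; rewrite /two_level; do 2!case: (_ < hook _ _ _) => //; lia.
have ev : v = v' :> nat.
  have := eG 0 0; rewrite /two_level -muE.
  by have -> : 0 < hook m h.+1 0 by rewrite hook_gt0.
have em : m = m' :> nat by apply/eqP; rewrite -(eqn_pmul2l v0) vm ev vm'.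
have eh : h = h' :> nat.
  have := muE h 0; have := muE h' 0; rewrite !hook_gt0 // !ltnSn /=; lia.
by congr (_, _, _); apply: val_inj.
Qed.

Lemma card_arrays1 : #|arrays_with n 1| = #|hook_params|.
Proof.
rewrite -(card_in_imset hook_array_inj); apply: eq_card => e.
apply/idP/imsetP => [|[p Pp ->]]; last exact: hook_array_mem.
move=> /mem_arrays[adm ncl /eqP/cards1P[[i' j'] c1]].
case/admissibleP: (adm) => rows cols sum five.
have uniq i j : corner (ext e) i j -> (i, j) = (nat_of_ord i', nat_of_ord j').
  move=> c; have /and3P[/pos_lt /andP[iN jN] _ _] := c.
  have : (Ordinal iN, Ordinal jN) \in [set x | corner_at e x] by rewrite inE.
  by rewrite c1 inE => /eqP[<- <-].
have [v [m [h [v0 h0 h5 hm eG]]]] :=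
  one_corner_shape (@ext_col_out n e) rows cols five ncl (admissible00 adm) uniq.
have mN : m - h < N.
  have /pos_lt /andP[_ //] : 0 < ext e 0 (m - h).
  by rewrite eG /two_level /hook /=; have -> : m - h < m.+1 - h by lia.
have hN : h.-1 < N.
  have /pos_lt /andP[// _] : 0 < ext e h.-1 0.
  by rewrite eG /two_level hook_gt0 //; have -> : h.-1 < h by lia.
have hmm : 0 < h <= m by rewrite h0.
have vm : v * m = N.
  rewrite -sum -(@sum_hook_array v m h) //; [|lia..].
  by apply: eq_bigr => i _; apply: eq_bigr => j _; rewrite eG.
have vN : v < N.+1 by nia.
have mN' : m < N.+1 by nia.
have h4 : h.-1 < 5 by lia.
have Pp : (Ordinal vN, Ordinal mN', Ordinal h4) \in hook_params.
  by rewrite inE /= vm eqxx; lia.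
exists (Ordinal vN, Ordinal mN', Ordinal h4) => //.
by apply: ext_inj => i j; rewrite ext_hook_array //= eG prednK.
Qed.


Local Notation strip_index := (K * K * ('I_5 * 'I_5 * 'I_5))%type.

Definition strip_level (p : strip_index) : nat -> nat -> nat :=
  let: ((u, v), (h, i0, i1)) := p in
  two_level u.1 v.1 (hook u.2 h.+1) (hook_strip u.2 v.2 h.+1 i0 i1).

Definition strip_array (p : strip_index) : array := truncate n (strip_level p).

Definition strip_params : {set strip_index} :=
  [set p : strip_index | let: ((u, v), (h, i0, i1)) := p in
    [&& v.1 < u.1, two_part_sizes N (np u) (np v) & strip_fits u.2 v.2 h.+1 i0 i1]].

(** Both values are positive, so [m1 + m2 <= N], and [hook_strip_bounds] places the shape inside the
    [N] by [N] square. *)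
Lemma strip_params_bounds a b m1 m2 h i0 i1 :
  0 < b -> b < a -> a * m1 + b * m2 = N -> strip_fits m1 m2 h i0 i1 ->
  [/\ h <= N, i1 < N & forall i, hook_strip m1 m2 h i0 i1 i <= N].
Proof.
move=> b0 ba sum fits; have [i1m lam_le] := hook_strip_bounds fits.
have mN : m1 + m2 <= N by nia.
case/and5P: fits => _ hm _ _ _; split=> [||i]; [lia|lia|].
by apply: leq_trans (lam_le i) mN.
Qed.

Lemma ext_strip_array p : p \in strip_params ->
  forall i j, ext (strip_array p) i j = strip_level p i j.
Proof.
case: p => -[[a m1] [b m2]] [[h i0] i1]; rewrite inE /= => /and3P[ba sol fits].
case/and5P: sol => /= a0 m10 b0 m20 /eqP sum.
have [hN i1N lamN] := strip_params_bounds b0 ba sum fits.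
apply: ext_truncate => i j /=.
- by rewrite /two_level; have := ltn_ord a; case: ifP => //; case: ifP; lia.
- move=> iN; rewrite /two_level.
  have mu0 : hook m1 h.+1 i = 0.
    by apply/eqP; rewrite -leqn0 leqNgt hook_gt0; case/and5P: fits => //; lia.
  have : (hook m1 h.+1 i < hook_strip m1 m2 h.+1 i0 i1 i) = false.
    by rewrite hook_strip_gt //; lia.
  by rewrite mu0 ltn0 => e; case: ifP; lia.
- move=> jN; rewrite /two_level; have := lamN i; have := hook_strip_ge fits i.
  by case: ifP; [lia|case: ifP; lia].
Qed.

Lemma strip_array_mem p : p \in strip_params -> strip_array p \in arrays_with n 2.
Proof.
move=> Pp; have eG := ext_strip_array Pp; move: Pp eG.
case: p => -[[a m1] [b m2]] [[h i0] i1]; rewrite inE /= => /and3P[ba sol fits].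
set e := strip_array _ => eG.
case/and5P: sol => /= a0 m10 b0 m20 /eqP sum.
have [hN i1N lamN] := strip_params_bounds b0 ba sum fits.
have [h0 hm i01 lt top] := and5P fits.
have mu_anti i : hook m1 h.+1 i.+1 <= hook m1 h.+1 i by apply: hook_anti.
have mu_hook i : hook m1 h.+1 i.+1 <= 1 by apply: hookS.
have lam_anti := hook_strip_anti fits; have mu_lam := hook_strip_ge fits.
have lamS := hook_stripS fits.
rewrite inE; apply/and3P; split.
- apply/admissibleP; split=> [i j|i j||i j i5]; rewrite ?eG.
  + exact: two_level_row.
  + exact: two_level_col.
  + under eq_bigr => i _ do under eq_bigr => j _ do rewrite eG.
    by rewrite sum_strip_array.
  + rewrite /two_level.
    have mu0 : hook m1 h.+1 i = 0.
      by apply/eqP; rewrite -leqn0 leqNgt hook_gt0 //; have := ltn_ord h; lia.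
    have : (hook m1 h.+1 i < hook_strip m1 m2 h.+1 i0 i1 i) = false.
      by rewrite hook_strip_gt //; have := ltn_ord i1; lia.
    by rewrite mu0 ltn0 => e0; case: ifP; lia.
- apply/forallP => x; rewrite /clash_at /= (eq_clash _ _ eG).
  by rewrite (negbTE (two_level_clash _ _ _ _ _ _ _ _ _)).
have mu0 : 0 < hook m1 h.+1 0 by rewrite hook_gt0.
have lam0 : hook m1 h.+1 i0 < hook_strip m1 m2 h.+1 i0 i1 i0.
  by rewrite hook_strip_gt // leqnn.
have c1N : (hook m1 h.+1 0).-1 < N by have := lamN 0; have := mu_lam 0; lia.
have c2N : (hook_strip m1 m2 h.+1 i0 i1 i0).-1 < N by have := lamN i0; lia.
have i0N : i0 < N by lia.
pose c1 := (ord0 : 'I_N, Ordinal c1N); pose c2 := (Ordinal i0N, Ordinal c2N).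
have ne : c1 != c2.
  rewrite xpair_eqE -!val_eqE /= negb_and; case: eqP => //= i00.
  by rewrite -i00 in lam0 *; lia.
apply/eqP; apply: etrans (_ : #|[set c1; c2]| = 2); last by rewrite cards2 ne.
apply: eq_card => -[i j]; rewrite [RHS]inE [X in _ = X || _]inE [X in _ = _ || X]inE.
rewrite /corner_at unfold_in /= (eq_corner _ _ eG) two_level_corner //.
rewrite hook_strip_corner // !xpair_eqE -!val_eqE /=; congr (_ || _).
  by congr (_ && _); lia.
case: (eqVneq (i : nat) i0) => [->|]; rewrite ?andbF ?andbT //=.
by lia.
Qed.

(** The two level sets determine [mu] and [lam]; [a] is read at the origin, [b] at the first strip
    cell of row [i0], the interval of strip rows where [mu < lam], and [m2] from the total. *)
Lemma strip_array_inj : {in strip_params &, injective strip_array}.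
Proof.
move=> p p' Pp Pp' e.
have eG i j : strip_level p i j = strip_level p' i j.
  by rewrite -!ext_strip_array // e.
move: p p' Pp Pp' eG {e} => [[[a m1] [b m2]] [[h i0] i1]] [[[a' m1'] [b' m2']] [[h' i0']
  i1']].
rewrite !inE /= => /and3P[ba sol fits] /and3P[ba' sol' fits'] eG.
case/and5P: sol => /= a0 m10 b0 m20 /eqP sum.
case/and5P: sol' => /= a0' m10' b0' m20' /eqP sum'.
have [h0 hm i01 lt top] := and5P fits.
have [h0' hm' i01' lt' top'] := and5P fits'.
have mu_lam := hook_strip_ge fits; have mu_lam' := hook_strip_ge fits'.
have mu0 : 0 < hook m1 h.+1 0 by rewrite hook_gt0.
have mu0' : 0 < hook m1' h'.+1 0 by rewrite hook_gt0.
have ea : a = a' :> nat by have := eG 0 0; rewrite /two_level mu0 mu0'.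
have muE i j : (j < hook m1 h.+1 i) = (j < hook m1' h'.+1 i).
  by have := eG i j; rewrite /two_level; do 4?case: ifP; lia.
have lamE i j : (j < hook_strip m1 m2 h.+1 i0 i1 i) = (j < hook_strip m1' m2' h'.+1 i0'
  i1' i).
  by have := eG i j; have := mu_lam i; have := mu_lam' i; rewrite /two_level;
    do 4?case: ifP; lia.
have eqn_lt (x y : nat) : (forall j, (j < x) = (j < y)) -> x = y.
  by move=> lt_xy; have := lt_xy x; have := lt_xy y; lia.
have {}muE i : hook m1 h.+1 i = hook m1' h'.+1 i by apply: eqn_lt.
have {}lamE i : hook_strip m1 m2 h.+1 i0 i1 i = hook_strip m1' m2' h'.+1 i0' i1' i by
  apply: eqn_lt.
have eb : b = b' :> nat.
  have := eG i0 (hook m1 h.+1 i0); have lt0 := hook_strip_gt fits i0.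
  rewrite /two_level -muE -lamE ltnn lt0 leqnn i01 /=; done.
have eh : h = h' :> nat.
  have := hook_gt0 h hm; have := hook_gt0 h' hm; rewrite !muE !hook_gt0 //; lia.
have em1 : m1 = m1' :> nat by have := muE 0; rewrite /hook /=; lia.
have ei (i : nat) : (i0 <= i <= i1) = (i0' <= i <= i1').
  by rewrite -(hook_strip_gt fits) -(hook_strip_gt fits') muE lamE.
have [ei0 ei1] : i0 = i0' :> nat /\ i1 = i1' :> nat.
  have := ei i0; have := ei i1; have := ei i0'; have := ei i1'; lia.
have em2 : m2 = m2' :> nat.
  apply/eqP; rewrite -(eqn_pmul2l b0); apply/eqP.
  by move: sum sum'; rewrite -ea -eb -em1; lia.
by congr (_, _, (_, _), (_, _, _)); apply: val_inj.
Qed.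

Lemma card_arrays2 : #|arrays_with n 2| = #|strip_params|.
Proof.
rewrite -(card_in_imset strip_array_inj); apply: eq_card => e.
apply/idP/imsetP => [|[p Pp ->]]; last exact: strip_array_mem.
move=> /mem_arrays[adm ncl /eqP/cards2P[[x1 x2] [[y1 y2] [ne cs]]]].
case/admissibleP: (adm) => rows cols sum five.
have bounded := @ext_col_out n e; have E00 := admissible00 adm.
have uniq i j : corner (ext e) i j ->
    (i, j) = (nat_of_ord x1, nat_of_ord x2) \/ (i, j) = (nat_of_ord y1, nat_of_ord y2).
  move=> c; have /and3P[/pos_lt /andP[iN jN] _ _] := c.
  have : (Ordinal iN, Ordinal jN) \in [set x | corner_at e x] by rewrite inE.
  by rewrite cs !inE => /orP[] /eqP[<- <-]; [left|right].
have cx : corner (ext e) x1 x2.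
  by have : (x1, x2) \in [set x | corner_at e x]; [rewrite cs !inE eqxx | rewrite inE].
have cy : corner (ext e) y1 y2.
  by have : (y1, y2) \in [set x | corner_at e x];
    [rewrite cs !inE eqxx orbT | rewrite inE].
have {}ne : (nat_of_ord x1, nat_of_ord x2) != (nat_of_ord y1, nat_of_ord y2).
  by move: ne; rewrite !xpair_eqE -!val_eqE.
set top := (0, (width (ext e) N (ext e 0 0) 0).-1).
(* One of the two corners ends the maximal entries of row 0; the other is named [(i0, j0)]. *)
have [i0 [j0 [other c0 uniq0]]] : exists i0 j0 : nat, [/\ (i0, j0) != top,
    corner (ext e) i0 j0 & forall i j, corner (ext e) i j -> (i, j) = top \/ (i, j) =
      (i0, j0)].
  case: (uniq _ _ (corner_top bounded rows cols E00)) => etop.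
    exists (nat_of_ord y1), (nat_of_ord y2); split; rewrite // /top ?etop //;
      first by rewrite eq_sym.
  exists (nat_of_ord x1), (nat_of_ord x2); split;
    rewrite // /top ?etop // => i j /uniq[]; by [right|left].
have [m1 [m2 [h [i1 [h5 i15 fits eG]]]]] :=
  two_corner_shape bounded rows cols five ncl E00 other c0 uniq0.
have ba := second_value_lt bounded rows cols E00 other c0.
have b0 : 0 < ext e i0 j0 by case/and3P: c0.
move: (ext e 0 0) (ext e i0 j0) E00 eG ba b0 => a b a0 eG ba b0.
have [h0 hm i01 lt _] := and5P fits.
have hN : h <= N.
  have /pos_lt /andP[h1 _] : 0 < ext e h.-1 0; last by lia.
  by rewrite eG /two_level hook_gt0 //; have -> : h.-1 < h by lia.
have i1N : i1 < N.
  have /pos_lt /andP[//] : 0 < ext e i1 (hook m1 h i1).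
  by rewrite eG /two_level ltnn hook_strip_gt // i01 leqnn.
have lamN i : hook_strip m1 m2 h i0 i1 i <= N.
  rewrite leqNgt; apply/negP => gt.
  have : 0 < ext e i N by rewrite eG /two_level gt; case: ifP; lia.
  by rewrite bounded.
have {}sum : a * m1 + b * m2 = N.
  rewrite -(sum_strip_array a b fits) // -[RHS]sum.
  by apply: eq_bigr => i _; apply: eq_bigr => j _; rewrite eG.
have m20 : 0 < m2 by move: lt; rewrite /strip_top; have := hook_anti hm i01; lia.
have aN : a < N.+1 by nia.
have bN : b < N.+1 by lia.
have m1N : m1 < N.+1 by nia.
have m2N : m2 < N.+1 by nia.
have h4 : h.-1 < 5 by lia.
have i05 : i0 < 5 by lia.
pose p : strip_index := ((Ordinal aN, Ordinal m1N), (Ordinal bN, Ordinal m2N),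
  (Ordinal h4, Ordinal i05, Ordinal i15)).
have Pp : p \in strip_params.
  by rewrite inE /= prednK // fits ba /two_part_sizes /= sum eqxx a0 b0 m20; lia.
exists p => //.
by apply: ext_inj => i j; rewrite ext_strip_array //= eG prednK.
Qed.

End CountArrays.

(** * Overpartitions *)

Section Sequences.
Variable n : nat.
Local Notation N := n.+1.
Local Notation K := ('I_N.+1 * 'I_N.+1)%type.
Local Notation np u := (nat_of_ord u.1, nat_of_ord u.2).
Local Notation sequence := {ffun 'I_N -> 'I_N.+1}.
Implicit Types (e : sequence) (s : marked_sequence N).

Definition sext e (i : nat) : nat := if i < N then nat_of_ord (e (inord i)) else 0.

Lemma sext_ord e (i : 'I_N) : sext e i = e i.
Proof. by rewrite /sext ltn_ord inord_val. Qed.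

Lemma sext_out e i : N <= i -> sext e i = 0.
Proof. by rewrite /sext leqNgt => /negbTE ->. Qed.

Lemma sext_inj e e' : (forall i, sext e i = sext e' i) -> e = e'.
Proof. by move=> h; apply/ffunP => i; apply/val_inj; have := h i; rewrite !sext_ord. Qed.

Definition struncate (S : nat -> nat) : sequence := [ffun i : 'I_N => inord (S i)].

Lemma sext_struncate (S : nat -> nat) :
  (forall i, S i <= N) -> (forall i, N <= i -> S i = 0) ->
  forall i, sext (struncate S) i = S i.
Proof.
move=> SN S0 i; rewrite /sext; case: (ltnP i N) => [iN|/S0 -> //].
by rewrite ffunE inordK // inordK // ltnS.
Qed.

Lemma is_partitionP e : reflect
  [/\ forall i, sext e i.+1 <= sext e i & \sum_(i < N) sext e i = N]
  (is_partition (mark0 e)).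
Proof.
have pE (i : 'I_N) : part (mark0 e) i = sext e i by rewrite /part ffunE sext_ord.
have -> : is_partition (mark0 e) =
    [forall i1 : 'I_N, forall i2 : 'I_N, (i1 <= i2) ==> (sext e i2 <= sext e i1)]
    && (\sum_(i < N) sext e i == N).
  congr (_ && _); first by do 2!apply: eq_forallb => ?; rewrite !pE.
  by congr (_ == _); apply: eq_bigr => i _; rewrite pE.
apply: (iffP andP) => [[/forallP anti /eqP sum]|[anti sum]]; split=> //.
- move=> i; case: (ltnP i.+1 N) => [i1|/sext_out -> //].
  have /forallP/(_ (Ordinal i1))/implyP := anti (Ordinal (ltnW i1)).
  exact.
- have antiD i d : sext e (i + d) <= sext e i.
    by elim: d => [|d IHd]; rewrite ?addn0 // addnS; apply: leq_trans (anti _) IHd.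
  apply/forallP => i1; apply/forallP => i2; apply/implyP => le.
  by rewrite -(subnKC le).
- exact/eqP.
Qed.

Definition first_occurrence (S : nat -> nat) (i : nat) : bool :=
  (0 < S i) && ((i == 0) || (S i.-1 != S i)).

Definition seq_overline_ok e (i : 'I_N) (o : bool) : bool :=
  let v := e i : nat in
  ((v == 0) ==> ~~ o) &&
  (((0 < v) && [exists i' : 'I_N, (i' < i) && (e i' == v :> nat)]) ==> ~~ o).

Lemma pbar_sum : pbar N = \sum_(e : sequence | is_partition (mark0 e))
  \prod_i (seq_overline_ok e i true + seq_overline_ok e i false).
Proof.
rewrite /pbar -(card_marked (fun e => is_partition (mark0 e))).
apply: eq_card => s; rewrite !inE.
have es i : part s i = part (mark0 (unmark s)) i by rewrite /part !ffunE.
have eu x : unmark s x = (s x).1 by rewrite ffunE.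
have -> : is_partition (mark0 (unmark s)) = is_partition s.
  congr (_ && _); first by do 2!apply: eq_forallb => ?; rewrite !es.
  by congr (_ == _); apply: eq_bigr => ? _; rewrite es.
congr (_ && _).
apply/andP/forallP => [[/forallP z /forallP r] i|ok].
  have := z i; have := r i.
  rewrite /seq_overline_ok !eu /part /part_overlined => r' z'; apply/andP; split => //.
  by move: r'; congr (_ && _ ==> _); apply: eq_existsb => k; rewrite ?eu.
split; apply/forallP => i.
- by have /andP[+ _] := ok i; rewrite !eu.
- have /andP[_ +] := ok i; rewrite !eu.
  by congr (_ && _ ==> _); apply: eq_existsb => k; rewrite ?eu.
Qed.

Lemma seq_overline_ok_count e i : is_partition (mark0 e) ->
  seq_overline_ok e i true + seq_overline_ok e i false =
  if first_occurrence (sext e) i then 2 else 1.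
Proof.
case/is_partitionP => anti _.
have antiD k d : sext e (k + d) <= sext e k.
  by elim: d => [|d IHd]; rewrite ?addn0 // addnS; apply: leq_trans (anti _) IHd.
rewrite /seq_overline_ok /first_occurrence sext_ord.
case: (posnP (e i)) => //= pos.
have -> : [exists k : 'I_N, (k < i) && (e k == e i :> nat)] =
    (0 < i) && (sext e i.-1 == e i).
  apply/existsP/andP => [[k /andP[ki /eqP ek]]|[i0 /eqP eqE]].
    have i0 : 0 < i by apply: leq_ltn_trans ki.
    split=> //; rewrite eqn_leq -ek -{1}sext_ord.
    have := antiD k (i.-1 - k); rewrite subnKC; last by lia.
    move=> -> /=; rewrite ek -sext_ord.
    by have := antiD i.-1 1; rewrite addn1 prednK.
  have iN : i.-1 < N by have := ltn_ord i; lia.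
  by exists (Ordinal iN); rewrite /= prednK // leqnn /= -eqE -sext_ord.
by case: (posnP i) => /= i0; rewrite ?i0 //=; case: (_ == _).
Qed.

Definition first_occurrence_at e : pred 'I_N := [pred i : 'I_N | first_occurrence (sext
  e) i].

Definition sequences_with k : {set sequence} :=
  [set e | is_partition (mark0 e) && (#|first_occurrence_at e| == k)].

Lemma partition0 e : is_partition (mark0 e) -> 0 < sext e 0.
Proof.
case/is_partitionP => anti sum; rewrite lt0n; apply/eqP => z; move: sum.
rewrite big1 // => i _; apply/eqP; rewrite -leqn0 -z.
by elim: (nat_of_ord i) => // k IHk; apply: leq_trans (anti k) IHk.
Qed.

Lemma pbar_mod8 :
  pbar N = 2 * #|sequences_with 1| + 4 * #|sequences_with 2| %[mod 8].
Proof.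
rewrite pbar_sum (eq_bigr (fun e => \prod_i
   (if first_occurrence_at e i then 2 else if pred0 i then 0 else 1))); last first.
  by move=> e ptn; apply: eq_bigr => i _; rewrite seq_overline_ok_count.
rewrite (@sum_weights_mod8 _ _ _ first_occurrence_at (fun=> pred0)).
  congr ((2 * _ + 4 * _) %% 8); apply: eq_card => e; rewrite !inE;
  by have -> : [forall x : 'I_N, ~~ pred0 x || first_occurrence_at e x] by apply/forallP.
move=> e ptn; apply/card_gt0P; exists ord0.
by rewrite unfold_in /= /first_occurrence /= partition0.
Qed.

(** Row 0 of a two-level array: [m1] copies of [a], then [m2] copies of [b]. Taking [b = m2 = 0]
    covers a single part size. *)
Definition seq_level (a b m1 m2 : nat) : nat -> nat :=
  two_level a b (fun=> m1) (fun=> m1 + m2) 0.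

Lemma sum_seq_level a b m1 m2 : m1 + m2 <= N ->
  \sum_(i < N) seq_level a b m1 m2 i = a * m1 + b * m2.
Proof. by move=> le; rewrite sum_two_level ?leq_addr // addKn. Qed.

Lemma first_seq_level a b m1 m2 i : b < a -> 0 < m1 ->
  first_occurrence (seq_level a b m1 m2) i = (i == 0) || [&& i == m1, 0 < b & 0 < m2].
Proof.
move=> ba m10; rewrite /first_occurrence /seq_level /two_level.
case: i => [|i] /=; first by rewrite m10; lia.
by case: (ltnP i.+1 m1); case: (ltnP i.+1 (m1 + m2)); case: (ltnP i m1);
  case: (ltnP i (m1 + m2)); lia.
Qed.

Lemma anti_seq_level a b m1 m2 i : b <= a ->
  seq_level a b m1 m2 i.+1 <= seq_level a b m1 m2 i.
Proof.
move=> ba; rewrite /seq_level /two_level.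
by case: (ltnP i.+1 m1); case: (ltnP i.+1 (m1 + m2)); case: (ltnP i m1);
  case: (ltnP i (m1 + m2)); lia.
Qed.

Lemma sext_seq_level a b m1 m2 : b <= a -> a <= N -> m1 + m2 <= N -> forall i,
  sext (struncate (seq_level a b m1 m2)) i = seq_level a b m1 m2 i.
Proof.
move=> ba aN mN; apply: sext_struncate => i; rewrite /seq_level /two_level.
  by case: ifP => // _; case: ifP; lia.
by case: ifP; [lia | case: ifP; lia].
Qed.

Lemma eq_first_occurrence S S' i : (forall i, S i = S' i) -> first_occurrence S i =
  first_occurrence S' i.
Proof. by move=> e; rewrite /first_occurrence !e. Qed.

(** The condition [(0 < b) = (0 < m2)] treats one and two part sizes together. *)
Lemma seq_level_inj a b m1 m2 a' b' m1' m2' :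
  b < a -> b' < a' -> 0 < m1 -> 0 < m1' -> (0 < b) = (0 < m2) -> (0 < b') = (0 < m2') ->
  (forall i, seq_level a b m1 m2 i = seq_level a' b' m1' m2' i) ->
  [/\ a = a', b = b', m1 = m1' & m2 = m2'].
Proof.
move=> ba ba' m10 m10' bm bm' e.
have ea : a = a' by have := e 0; rewrite /seq_level /two_level m10 m10'.
have lt1 i : (i < m1) = (i < m1').
  by have := e i; rewrite /seq_level /two_level; do 4?case: ifP; lia.
have em : m1 = m1' by have := lt1 m1; have := lt1 m1'; lia.
have lt2 i : (i < m1 + m2) = (i < m1' + m2').
  by have := e i; rewrite /seq_level /two_level; do 4?case: ifP; lia.
have em2 : m2 = m2' by have := lt2 (m1 + m2); have := lt2 (m1' + m2'); lia.
split=> //; have := e m1; rewrite /seq_level /two_level -em -em2 ltnn.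
by case: (posnP m2) => m20; [lia | have -> : m1 < m1 + m2 by lia].
Qed.

Definition sizes1 : {set K} := [set u : K | u.1 * u.2 == N :> nat].

Definition sizes2 : {set K * K} :=
  [set p : K * K | (p.2.1 < p.1.1) && two_part_sizes N (np p.1) (np p.2)].

Lemma positive_level e m k : is_partition (mark0 e) -> k <= m ->
  (forall i, (0 < sext e i) = (i < m)) ->
  (forall i, k < i -> ~~ first_occurrence (sext e) i) ->
  forall i, k <= i -> sext e i = if i < m then sext e k else 0.
Proof.
move=> ptn km pos nf i ki; rewrite -pos; case: posnP => // p.
rewrite -(subnKC ki); rewrite -(subnKC ki) in p; move: (i - k) p => d {ki i}.
elim: d => [|d IHd]; rewrite ?addn0 // addnS => p.
have := nf (k + d).+1; rewrite /first_occurrence p /= negbK => /(_ _)/eqP h.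
rewrite -h; last by lia.
apply: IHd; rewrite h //; lia.
Qed.

Lemma positive_threshold e : is_partition (mark0 e) ->
  exists2 m, m <= N & forall i, (0 < sext e i) = (i < m).
Proof.
case/is_partitionP => anti _; apply: threshold => [i|]; last by rewrite sext_out.
by move/leq_trans; apply.
Qed.

Lemma card_sequences1 : #|sequences_with 1| = #|sizes1|.
Proof.
pose f (u : K) := struncate (seq_level u.1 0 u.2 0).
have fE u : u \in sizes1 ->
    [/\ 0 < u.1, 0 < u.2 & forall i, sext (f u) i = seq_level u.1 0 u.2 0 i].
  rewrite inE => /eqP e; have u10 : 0 < u.1 by rewrite lt0n; apply/eqP => z;
    rewrite z in e.
  have u20 : 0 < u.2 by rewrite lt0n; apply/eqP => z; rewrite z muln0 in e.
  split=> //; by apply: sext_seq_level; rewrite ?addn0 // -ltnS ltn_ord.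
have f_inj : {in sizes1 &, injective f}.
  move=> u v Pu Pv e; have [u1 u2 uE] := fE _ Pu; have [v1 v2 vE] := fE _ Pv.
  have [||||||i|e1 _ e2 _] := @seq_level_inj u.1 0 u.2 0 v.1 0 v.2 0 => //.
    by rewrite -uE e vE.
  by rewrite [u]surjective_pairing [v]surjective_pairing; congr (_, _); apply: val_inj.
rewrite -(card_in_imset f_inj); apply: eq_card => e.
apply/idP/imsetP => [|[u Pu ->]]; last first.
  have [u1 u2 uE] := fE _ Pu; rewrite inE; apply/andP; split.
    apply/is_partitionP; split=> [i|]; first by rewrite !uE anti_seq_level.
    under eq_bigr => i _ do rewrite uE.
    rewrite sum_seq_level; last by have := ltn_ord u.2; lia.
    by rewrite addn0; move: Pu; rewrite inE => /eqP.
  apply/eqP; apply: etrans (cards1 (ord0 : 'I_N)); apply: eq_card => i.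
  rewrite [RHS]inE unfold_in /= (eq_first_occurrence _ uE) first_seq_level //.
  by rewrite andbF orbF -val_eqE.
rewrite inE => /andP[ptn c1]; have [anti sum] := is_partitionP _ ptn.
have e0 := partition0 ptn; have [m mN mP] := positive_threshold ptn.
have nf i : 0 < i -> ~~ first_occurrence (sext e) i.
  move=> i0; apply/negP => fi.
  have iN : i < N by rewrite ltnNge; apply/negP => /(sext_out e) h; move: fi;
    rewrite /first_occurrence h.
  have : #|[set ord0; Ordinal iN]| <= #|first_occurrence_at e|.
    apply/subset_leq_card/subsetP => x; rewrite !inE => /orP[] /eqP -> //=.
    by rewrite /first_occurrence e0.
  by rewrite (eqP c1) cards2 -val_eqE /=; lia.
have eE i := positive_level ptn (leq0n m) mP nf (leq0n i).
have {}eE i : sext e i = seq_level (sext e 0) 0 m 0 i.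
  by rewrite {1}eE /seq_level /two_level if_same.
have sumE : sext e 0 * m = N.
  rewrite -[RHS]sum (eq_bigr _ (fun i _ => eE (nat_of_ord i))) sum_seq_level ?addn0 //.
have aN : sext e 0 < N.+1 by rewrite /sext /= ltn_ord.
exists (Ordinal aN, Ordinal (mN : m < N.+1)); first by rewrite inE /= sumE.
have Pu : (Ordinal aN, Ordinal (mN : m < N.+1)) \in sizes1 by rewrite inE /= sumE.
by have [_ _ uE] := fE _ Pu; apply: sext_inj => i; rewrite uE /= -eE.
Qed.

Lemma card_sequences2 : #|sequences_with 2| = #|sizes2|.
Proof.
pose f (p : K * K) := struncate (seq_level p.1.1 p.2.1 p.1.2 p.2.2).
have fE p : p \in sizes2 -> [/\ p.2.1 < p.1.1, 0 < p.1.2, 0 < p.2.1, 0 < p.2.2 &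
    [/\ p.1.2 + p.2.2 <= N, p.1.1 * p.1.2 + p.2.1 * p.2.2 = N &
    forall i, sext (f p) i = seq_level p.1.1 p.2.1 p.1.2 p.2.2 i]].
  rewrite inE => /andP[ba /and5P[/= a0 m10 b0 m20 /eqP sum]]; split=> //.
  have mN : p.1.2 + p.2.2 <= N.
    by rewrite -[X in _ <= X]sum leq_add // leq_pmull.
  by split=> //; apply: sext_seq_level; rewrite // ?(ltnW ba) // -ltnS ltn_ord.
have f_inj : {in sizes2 &, injective f}.
  move=> p q Pp Pq e; have [ba m10 b0 m20 [_ _ pE]] := fE _ Pp.
  have [ba' m10' b0' m20' [_ _ qE]] := fE _ Pq.
  have [||||||i|e1 e2 e3 e4] :=
    @seq_level_inj p.1.1 p.2.1 p.1.2 p.2.2 q.1.1 q.2.1 q.1.2 q.2.2 => //.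
  - by rewrite b0 m20.
  - by rewrite b0' m20'.
  - by rewrite -pE e qE.
  by move: p q e1 e2 e3 e4 {Pp Pq e ba m10 b0 m20 pE ba' m10' b0' m20' qE}
    => [[a m1] [b m2]] [[a' m1'] [b' m2']] /= *; congr (_, _, (_, _)); apply: val_inj.
rewrite -(card_in_imset f_inj); apply: eq_card => e.
apply/idP/imsetP => [|[p Pp ->]]; last first.
  have [ba m10 b0 m20 [mN sum pE]] := fE _ Pp; rewrite inE; apply/andP; split.
    apply/is_partitionP; split=> [i|]; first by rewrite !pE anti_seq_level // ltnW.
    by under eq_bigr => i _ do rewrite pE; rewrite sum_seq_level.
  have m1N : p.1.2 < N by lia.
  apply/eqP; apply: etrans (_ : #|[set ord0; Ordinal m1N]| = 2); last first.
    by rewrite cards2 -val_eqE /= eq_sym -lt0n m10.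
  apply: eq_card => i; rewrite [RHS]inE ![in RHS]inE unfold_in /= (eq_first_occurrence _
    pE).
  by rewrite first_seq_level // b0 m20 !andbT -!val_eqE.
rewrite inE => /andP[ptn c2]; have [anti sum] := is_partitionP _ ptn.
have e0 := partition0 ptn; have [m mN mP] := positive_threshold ptn.
(* [k] is the position where the smaller part begins. *)
have [k kP] : exists k : 'I_N, k != ord0 /\ forall i : 'I_N, first_occurrence (sext e) i
  = (i == ord0) || (i == k).
  have f0 : ord0 \in [set i | first_occurrence_at e i] by rewrite inE; apply/andP; split;
    first exact: e0.
  have : #|[set i | first_occurrence_at e i]| == 2 by rewrite cardsE.
  case/cards2P => x [y [xy fs]]; move: f0; rewrite fs !inE.
  have fP (i : 'I_N) : first_occurrence (sext e) i = (i == x) || (i == y).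
    by have : (i \in [set i | first_occurrence_at e i]) = (i \in [set x; y]);
      [rewrite fs | rewrite !inE].
  case/orP => /eqP e0x; first by exists y; rewrite -e0x in xy fP *; rewrite eq_sym.
  by exists x; rewrite -e0x in xy fP *; split=> // i; rewrite fP orbC.
case: kP => k0 kP; have fk : first_occurrence (sext e) k by rewrite kP eqxx orbT.
have {}k0 : 0 < k by rewrite lt0n.
have fP i : first_occurrence (sext e) i -> i = 0 \/ i = k.
  move=> fi; have iN : i < N.
    by rewrite ltnNge; apply/negP => /(sext_out e) h; move: fi;
      rewrite /first_occurrence h.
  by have := kP (Ordinal iN); rewrite fi => /esym /orP[] /eqP h; [left|right];
    have := congr1 val h.
have km : k < m by rewrite -mP; case/andP: fk.
have lowE i : i < k -> sext e i = sext e 0.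
  elim: i => // i IHi ik; have := fP i.+1; rewrite /first_occurrence mP /=.
  case: eqP => [<- _|_ h]; first by apply: IHi; lia.
  by have [] := h; lia.
have highE i : k <= i -> sext e i = if i < m then sext e k else 0.
  apply: positive_level => // [|j kj]; first exact: ltnW.
  by apply/negP => /fP; lia.
have eE i : sext e i = seq_level (sext e 0) (sext e k) k (m - k) i.
  rewrite /seq_level /two_level subnKC ?(ltnW km) //; case: ltnP => [/lowE //|/highE //].
have ba : sext e k < sext e 0.
  case/andP: fk => _; rewrite gtn_eqF //= (lowE k.-1); last by lia.
  by have := anti k.-1; rewrite prednK // (lowE k.-1); lia.
have b0 : 0 < sext e k by case/andP: fk.
have sumE : sext e 0 * k + sext e k * (m - k) = N.
  rewrite -[RHS]sum (eq_bigr _ (fun i _ => eE (nat_of_ord i))) sum_seq_level // subnKC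
    //; exact: ltnW.
have aN : sext e 0 < N.+1 by rewrite /sext /= ltn_ord.
have bN : sext e k < N.+1 by rewrite /sext; case: ifP => // _; rewrite ltn_ord.
have m1N : k < N.+1 by have := ltn_ord k; lia.
have m2N : m - k < N.+1 by lia.
pose p : K * K := ((Ordinal aN, Ordinal m1N), (Ordinal bN, Ordinal m2N)).
have Pp : p \in sizes2.
  by rewrite inE /= ba /two_part_sizes /= sumE eqxx; lia.
exists p => //; have [_ _ _ _ [_ _ pE]] := fE _ Pp.
by apply: sext_inj => i; rewrite pE /= -eE.
Qed.

End Sequences.

(** * The congruence modulo 8 *)

Section Congruence.
Variable n : nat.
Local Notation N := n.+1.
Local Notation K := ('I_N.+1 * 'I_N.+1)%type.
Hypothesis N_mod12 : (N %% 12 == 1) || (N %% 12 == 5).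

(** A factorization [a * m = N] yields [minn 5 m] hooks. As 2, 3 and 4 do not divide [N], this is 1
    or 5, hence 1 modulo 4. *)
Lemma card_hook_params_mod4 : #|hook_params n| = #|sizes1 n| %[mod 4].
Proof.
have -> : #|hook_params n| = \sum_(u : K | u.1 * u.2 == N :> nat) minn 5 u.2.
  rewrite -sum1_card (eq_bigl (fun p : K * 'I_5 => (p.1.1 * p.1.2 == N :> nat) && (p.2 <
    p.1.2))).
    rewrite -(pair_big_dep (fun u : K => u.1 * u.2 == N :> nat)
      (fun (u : K) (h : 'I_5) => h < u.2) (fun _ _ => 1)) /=.
    by apply: eq_bigr => u _; rewrite -sum_ltn [LHS]big_mkcond.
  by move=> p; rewrite inE.
have -> : #|sizes1 n| = \sum_(u : K | u.1 * u.2 == N :> nat) 1.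
  by rewrite -sum1_card; apply: eq_bigl => u; rewrite inE.
apply: (big_ind2 (fun u v => u = v %[mod 4])) => //.
  by move=> u u' v v' h h'; rewrite -modnDm h h' modnDm.
move=> u /eqP; move: (nat_of_ord u.1) (nat_of_ord u.2) => a m e.
have [-> //|m1] := eqVneq m 1.
suff : 5 <= m by move=> m5; rewrite (minn_idPl m5).
case: m e m1 => [|[|[|[|[|m]]]]] //; lia.
Qed.

Lemma odd_sum (I : finType) (F : I -> nat) :
  odd (\sum_i F i) = \xor_(i : I) odd (F i).
Proof. exact: (big_morph odd oddD). Qed.

(** Each solution with [a > b] is weighted by [strip_count] on one side and by 1 on the other; the
    parities differ by [xor_gt N strip_parity], which vanishes. *)
Lemma odd_strip_params : odd #|strip_params n| = odd #|sizes2 n|.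
Proof.
pose R (u v : K) := (v.1 < u.1) &&
  two_part_sizes N (nat_of_ord u.1, nat_of_ord u.2) (nat_of_ord v.1, nat_of_ord v.2).
have -> : #|strip_params n| = \sum_(u : K) \sum_(v : K) R u v * strip_count u.2 v.2.
  rewrite pair_bigA /= /strip_count.
  under eq_bigr => p _ do rewrite pair_bigA pair_bigA big_distrr /=.
  rewrite pair_bigA /= -sum1_card big_mkcond; apply: eq_bigr => -[[u v] [[h i0] i1]] _.
  rewrite inE /R /=.
  by case: (_ < _); case: two_part_sizes; case: strip_fits.
have -> : #|sizes2 n| = \sum_(u : K) \sum_(v : K) R u v.
  by rewrite pair_bigA /= -sum1_card big_mkcond; apply: eq_bigr => -[u v] _; rewrite inE.
have oddR : odd (\sum_(u : K) \sum_(v : K) R u v) = \xor_(u : K) \xor_(v : K) R u v.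
  rewrite odd_sum; apply: eq_bigr => u _; rewrite odd_sum; apply: eq_bigr => v _.
  by case: (R u v).
suff -> : odd (\sum_(u : K) \sum_(v : K) R u v * strip_count u.2 v.2) =
    (\xor_(u : K) \xor_(v : K) R u v) (+) xor_gt N strip_parity.
  by rewrite xor_gt_strip_parity // addbF.
rewrite odd_sum -big_split; apply: eq_bigr => u _.
rewrite odd_sum -big_split; apply: eq_bigr => v _ /=.
rewrite /R; case: (_ < _) => //=; case: (boolP (two_part_sizes _ _ _)) => //=.
by case/and5P => /= _ u2 _ v2 _; rewrite mul1n odd_strip_count.
Qed.

Lemma plbar5_pbar_mod8 : plbar 5 N = pbar N %[mod 8].
Proof.
rewrite plbar_mod8 pbar_mod8 card_arrays1 card_arrays2 card_sequences1 card_sequences2.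
(* The count with factor 2 matters only modulo 4, the one with factor 4 only modulo 2. *)
have := card_hook_params_mod4; have := odd_strip_params.
lia.
Qed.

End Congruence.

Theorem theorem1p10 (n : nat) :
  plbar 5 (12 * n + 1) = pbar (12 * n + 1) %[mod 8] /\
  plbar 5 (12 * n + 5) = pbar (12 * n + 5) %[mod 8].
Proof.
(* Both arguments are brought to successor form. *)
rewrite addn1 addnS; split; apply: plbar5_pbar_mod8; lia.
Qed.
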